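(* Let $K$ be a convex curve embedded into $\mathbb{R}^d$, let $n$ be a nonnegative integer, and let $f$ be a continuous real function on $K$, not identically zero. Suppose that on $K$ there exists a parametrization $s\mapsto x(s)$ such that $$\int_K P(x(s))\,f(s)\,ds=0$$ for every real polynomial $P$ in $d$ variables of degree not higher than $n$ (where $f(s)$ denotes the value of $f$ at $x(s)$). Then $f$ has at least $dn+2$ zeros (sign changes) on $K$ if $K$ is a closed curve, and at least $dn+1$ zeros (sign changes) on $K$ if $K$ is not closed.
   Context: A curve $K$ in $\mathbb{R}^d$ is the image of an embedding of the circle, $\sigma:S^1\to\mathbb{R}^d$ (closed curve), or of an interval, $\sigma:(a,b)\to\mathbb{R}^d$ (nonclosed curve). No smoothness is required. A hyperplane is an affine subspace of dimension $d-1$. A curve $K$ is convex if it intersects any hyperplane at no more than $d$ points counted with multiplicity. The multiplicity of an intersection point of $K$ with a hyperplane is the largest number of intersection points lying in a small neighborhood of that point after a slight perturbation of the hyperplane. Zeros are understood as sign changes: for a continuous function $f$ on $K$, $f$ changes sign on a connected component of its zero set if in any neighborhood of this component there exist two points at which the values of $f$ have opposite (nonzero) signs. The number of zeros (sign changes) of $f$ is the number of connected components of the zero set on which $f$ changes sign. *)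

(* Defs.v *)
From HB Require Import structures.
From mathcomp Require Import all_boot all_order all_algebra.
From mathcomp Require mpoly.

Set Implicit Arguments.
Unset Strict Implicit.
Unset Printing Implicit Defensive.

(* The notations of mpoly clash with those of the analysis library, so mpoly is
   imported in this module only. *)
Module MPolynomial.
Import mpoly.
Local Open Scope ring_scope.

(* msize is 1 + the total degree (and 0 for the zero polynomial). *)
Definition degree_le (R : nzRingType) (d n : nat) (P : {mpoly R[d]}) : Prop :=
  (msize P <= n.+1)%N.

Definition eval (R : comNzRingType) (d : nat) (P : {mpoly R[d]})
    (x : 'rV[R]_d) : R :=
  P.@[fun i => x 0 i].

End MPolynomial.

From mathcomp Require Import all_classical all_reals all_analysis.

Import Order.TTheory GRing.Theory Num.Theory.
Import numFieldNormedType.Exports.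

Local Open Scope classical_set_scope.
Local Open Scope card_scope.
Local Open Scope ring_scope.

(* The last clause says that g is relatively open onto its image, i.e. that
   the inverse map g @` A -> A is continuous for the subspace topologies. *)
Definition embedding_on (T U : topologicalType) (A : set T) (g : T -> U)
    : Prop :=
  [/\ {within A, continuous g},
      set_inj A g &
      forall O : set T, open O ->
        exists2 V : set U, open V & g @` (A `&` O) = (g @` A) `&` V].

Definition unit_circle (R : realType) : set (R * R) :=
  [set u | u.1 ^+ 2 + u.2 ^+ 2 = 1].

(* The endpoints may be infinite. *)
Definition open_itv (R : realType) (a b : \bar R) : set R :=
  [set s | (a < s%:E < b)%E].

Definition closed_curve (R : realType) (d : nat) (K : set 'rV[R]_d) : Prop :=
  exists2 sigma : R * R -> 'rV[R]_d,
    embedding_on (@unit_circle R) sigma & sigma @` @unit_circle R = K.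

Definition nonclosed_curve (R : realType) (d : nat) (K : set 'rV[R]_d)
    : Prop :=
  exists a b : \bar R, (a < b)%E /\
    exists2 sigma : R -> 'rV[R]_d,
      embedding_on (open_itv a b) sigma & sigma @` open_itv a b = K.

(* The parameter s runs over the circle obtained from [alpha, beta] by gluing
   its endpoints; by compactness, such a continuous bijection from that circle
   to K is a homeomorphism. *)
Definition closed_parametrization (R : realType) (d : nat) (K : set 'rV[R]_d)
    (alpha beta : R) (x : R -> 'rV[R]_d) : Prop :=
  [/\ alpha < beta,
      {within `[alpha, beta], continuous x},
      x alpha = x beta,
      set_inj `[alpha, beta[ x &
      x @` `[alpha, beta] = K].

Definition nonclosed_parametrization (R : realType) (d : nat)
    (K : set 'rV[R]_d) (a b : \bar R) (x : R -> 'rV[R]_d) : Prop :=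
  [/\ (a < b)%E, embedding_on (open_itv a b) x & x @` open_itv a b = K].

(* This is an affine subspace of dimension d - 1 exactly when h.1 != 0, and
   every such subspace is of this form. *)
Definition hyperplane (R : realType) (d : nat) (h : 'rV[R]_d * R)
    : set 'rV[R]_d :=
  [set x | \sum_(i < d) h.1 0 i * x 0 i = h.2].

(* In every neighbourhood U of p, arbitrarily small perturbations of the
   hyperplane meet K in at least m points.  Hyperplanes are perturbed through
   their coefficients: the set of hyperplanes is the quotient of the space of
   coefficients by nonzero scalings, and the quotient map is open, so
   neighbourhoods of h and of its hyperplane correspond. *)
Definition perturbs_to_at_least (R : realType) (d : nat) (K : set 'rV[R]_d)
    (h : 'rV[R]_d * R) (p : 'rV[R]_d) (m : nat) : Prop :=
  forall (U : set 'rV[R]_d) (W : set ('rV[R]_d * R)), nbhs p U -> nbhs h W ->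
    exists h' : 'rV[R]_d * R,
      [/\ W h', h'.1 != 0 & `I_m #<= K `&` hyperplane h' `&` U].

Definition multiplicity (R : realType) (d : nat) (K : set 'rV[R]_d)
    (h : 'rV[R]_d * R) (p : 'rV[R]_d) : \bar R :=
  ereal_sup [set (m%:R)%:E | m in [set m | perturbs_to_at_least K h p m]].

Definition convex_curve (R : realType) (d : nat) (K : set 'rV[R]_d) : Prop :=
  (closed_curve K \/ nonclosed_curve K) /\
  forall h : 'rV[R]_d * R, h.1 != 0 ->
    (\esum_(p in K `&` hyperplane h) multiplicity K h p <= (d%:R)%:E)%E.

Definition zero_set (R : realType) (d : nat) (K : set 'rV[R]_d)
    (f : 'rV[R]_d -> R) : set 'rV[R]_d :=
  [set p | K p /\ f p = 0].

Definition zero_components (R : realType) (d : nat) (K : set 'rV[R]_d)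
    (f : 'rV[R]_d -> R) : set (set 'rV[R]_d) :=
  [set connected_component (zero_set K f) p | p in zero_set K f].

(* Neighbourhoods of C in K are the traces on K of open sets containing C. *)
Definition changes_sign_on (R : realType) (d : nat) (K : set 'rV[R]_d)
    (f : 'rV[R]_d -> R) (C : set 'rV[R]_d) : Prop :=
  forall U : set 'rV[R]_d, open U -> C `<=` U ->
    exists p q : 'rV[R]_d, [/\ (K `&` U) p, (K `&` U) q, 0 < f p & f q < 0].

Definition sign_changes (R : realType) (d : nat) (K : set 'rV[R]_d)
    (f : 'rV[R]_d -> R) : set (set 'rV[R]_d) :=
  [set C | zero_components K f C /\ changes_sign_on K f C].

(* D is the domain of the parameter s. *)
Definition orthogonal_to_polynomials (R : realType) (d n : nat) (D : set R)
    (x : R -> 'rV[R]_d) (f : 'rV[R]_d -> R) : Prop :=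
  forall P : mpoly.mpoly d R, MPolynomial.degree_le n P ->
    let g := fun s : R => MPolynomial.eval P (x s) * f (x s) in
    lebesgue_measure.-integrable D (EFin \o g) /\
    (\int[lebesgue_measure]_(s in D) (g s)%:E = 0)%E.

(* Main.v *)
(* If f had fewer sign changes, some polynomial P of degree at most n would make
   P f nonnegative on K and not identically zero, against orthogonality.

   Given d points of a convex curve, the hyperplane through them meets K nowhere
   else, and its affine function changes sign at each of them: at a point where
   it did not, a small parallel shift of the hyperplane would produce two nearby
   intersection points, so the multiplicities would add up to more than d.  A
   product of n such affine functions then changes sign at d n prescribed
   points.  When fewer points are prescribed, or when some coincide, a limit of
   normalized affine functions keeps the signs in the weak sense, which is
   enough because a nonzero affine function vanishes at most d times on K.

   Hence f takes values of alternating signs at some d n + 2 points, and each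
   gap between consecutive ones contains a component of the zero set on which f
   changes sign.  On a closed curve d is even, because the affine function above
   returns to its initial sign; the last of the d n + 2 values is then opposite
   to the first, and the arc closing the circle contains one more such
   component. *)

Require Import Defs.
From HB Require Import structures.
From mathcomp Require Import all_boot all_order all_algebra.
From mathcomp Require mpoly.

Set Implicit Arguments.
Unset Strict Implicit.
Unset Printing Implicit Defensive.

(** * Products of affine functions as polynomials *)

(* The notations of mpoly clash with those of the analysis library. *)
Module AffineProduct.
Import mpoly GRing.Theory.
Local Open Scope ring_scope.

(** Each factor has [msize] at most 2, so multiplying by it raises the degree bound by one. *)
Lemma affine_product_polynomial (R : idomainType) (d : nat)
    (hs : seq ('rV[R]_d * R)) (c : R) :
  exists2 P : {mpoly R[d]}, MPolynomial.degree_le (size hs) P &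
    forall p, MPolynomial.eval P p =
      c * \prod_(h <- hs) (\sum_(i < d) h.1 0 i * p 0 i - h.2).
Proof.
elim: hs => [|h hs [P dP evP]].
  exists c%:MP; first by rewrite /MPolynomial.degree_le msizeC; case: (c != 0).
  by move=> p; rewrite /MPolynomial.eval mevalC big_nil mulr1.
pose L : {mpoly R[d]} := \sum_(i < d) h.1 0 i *: 'X_i - (h.2)%:MP.
have sL : (msize L <= 2)%N.
  rewrite /L -mpolyCN; apply: leq_trans (msizeD_le _ _) _.
  rewrite geq_max; apply/andP; split; last by rewrite msizeC; case: (_ != _).
  apply: leq_trans (msize_sum _ _ _) _.
  apply/bigmax_leqP => i _; apply: leq_trans (msizeZ_le _ _) _.
  by rewrite msizeX mdeg1.
exists (L * P).
  rewrite /MPolynomial.degree_le /=.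
  (* The size formula for a product requires nonzero factors, while [h] and [c] are arbitrary. *)
  have [->|L0] := eqVneq L 0; first by rewrite mul0r msize0.
  have [->|P0] := eqVneq P 0; first by rewrite mulr0 msize0.
  rewrite msizeM// -ltnS prednK.
    by apply: leq_trans (leq_add sL dP) _; rewrite add2n.
  by rewrite addn_gt0 lt0n msize_poly_eq0 L0.
move=> p; rewrite /MPolynomial.eval mevalM -/(MPolynomial.eval P p) evP
  big_cons.
rewrite mulrCA; congr (_ * (_ * _)).
rewrite /L mevalB mevalC; congr (_ - _).
by rewrite raddf_sum; apply: eq_bigr => i _; rewrite /= mevalZ mevalXU.
Qed.
End AffineProduct.

From mathcomp Require Import all_classical all_reals all_analysis.
From mathcomp Require Import measurable_realfun ring lra.
Import Order.TTheory GRing.Theory Num.Theory.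
Import numFieldNormedType.Exports.
Local Open Scope classical_set_scope.
Local Open Scope card_scope.
Local Open Scope ring_scope.

(** * Alternating values *)

Section Alternation.
Variable R : realType.
Implicit Types (F : R -> R) (D : set R) (l ts : seq R).

(** Only the sign of [e] matters: it is the sign of the first value. With a real multiplier, the
    tail of a list is described by [- e]. *)
Definition alternating (e : R) F D l : Prop :=
  sorted <%R l /\
  forall i, (i < size l)%N -> D l`_i /\ 0 < e * (-1) ^+ i * F l`_i.

Lemma alternating_cons e F D s l :
  D s -> 0 < e * F s -> (forall r, r \in l -> s < r) ->
  alternating (- e) F D l -> alternating e F D (s :: l).
Proof.
move=> Ds Fs sl [sol al]; split.
  by case: l sl sol {al} => //= r l sl ->; rewrite sl ?inE ?eqxx.
case=> [_|i /= il]; first by rewrite expr0 mulr1.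
by have [? ?] := al i il; split=> //; rewrite exprS mulN1r mulrN -mulNr.
Qed.

Lemma alternating_subset e F D D' l :
  D `<=` D' -> alternating e F D l -> alternating e F D' l.
Proof. by move=> DD' [sl al]; split=> // i /al[/DD']. Qed.

Lemma alternating_mem e F D l r : alternating e F D l -> r \in l -> D r.
Proof.
move=> [_ al] rl; have := al (index r l).
by rewrite index_mem nth_index// => /(_ rl) [].
Qed.

Lemma alternating_mul e F D l i : alternating e F D l -> (i.+1 < size l)%N ->
  F l`_i * F l`_i.+1 < 0.
Proof.
move=> [_ al] il; have [_ Fi] := al i (ltnW il); have [_ Fi1] := al _ il.
have := mulr_gt0 Fi Fi1.
have -> : e * (-1) ^+ i * F l`_i * (e * (-1) ^+ i.+1 * F l`_i.+1) =
  - (F l`_i * F l`_i.+1) * (e * (-1) ^+ i) ^+ 2 by rewrite exprS; ring.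
have e0 : e * (-1) ^+ i != 0 by apply: contraTneq Fi => ->; rewrite mul0r ltxx.
by rewrite pmulr_lgt0 ?oppr_gt0// exprn_even_gt0.
Qed.

(** A model for prescribed sign switches: positive to the left of [ts], it changes sign at each
    point of odd multiplicity in [ts]. *)
Definition sgn_prod ts (s : R) : R := \prod_(t <- ts) (t - s).

Lemma sgn_prod_cons (t : R) ts s :
  sgn_prod (t :: ts) s = (t - s) * sgn_prod ts s.
Proof. by rewrite /sgn_prod big_cons. Qed.

Lemma sgn_prod_neq0 ts s : s \notin ts -> sgn_prod ts s != 0.
Proof.
move=> sts; rewrite /sgn_prod prodf_seq_neq0; apply/allP => t tts /=.
by rewrite subr_eq0; apply: contraNneq sts => <-.
Qed.

Lemma sgn_prod_continuous ts : continuous (sgn_prod ts).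
Proof.
apply: continuous_big => [|t _]; first exact: mul_continuous.
by move=> s; apply: continuousB; [exact: cst_continuous|exact: cvg_id].
Qed.

(* The first switching point is the infimum of {s | 0 < e * F s}; the others come
   from the part of D to its right, with - e. *)
Lemma sign_pattern k (e : R) F D (u : R) :
  e != 0 ->
  (forall s, D s -> 0 < e * F s -> u <= s) ->
  (forall l, size l = k.+1 -> ~ alternating e F D l) ->
  exists ts, [/\ (size ts <= k)%N,
    (forall t, t \in ts -> u <= t /\ exists2 s, D s & t <= s) &
    forall s, D s -> e * F s * sgn_prod ts s <= 0].
Proof.
elim: k e D u => [|k IH] e D u e0 uD nl.
  exists [::]; split=> // s Ds; rewrite /sgn_prod big_nil mulr1 leNgt.
  apply/negP => Fs; apply: (nl [:: s]) => //; split=> // -[|//] _ /=.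
  by rewrite expr0 mulr1.
pose A := [set s | D s /\ 0 < e * F s].
have [[s0 As0]|nA] := pselect (A !=set0); last first.
  exists [::]; split=> // s Ds; rewrite /sgn_prod big_nil mulr1 leNgt.
  by apply/negP => Fs; apply: nA; exists s.
have hA : has_inf A.
  by split; [exists s0|exists u => s [Ds Fs]; apply: uD].
pose t := inf A.
have lt_t : lbound A t by apply: inf_lbound; case: hA.
pose D' := D `&` [set s | t < s].
have [|||ts [sts Hts Fts]] := IH (- e) D' t.
- by rewrite oppr_eq0.
- by move=> s [_ /ltW].
- case=> // q l sl al.
  have [_ tq] : D' q by apply: (alternating_mem al); rewrite inE eqxx.
  (* Since [t] is the infimum of [A] and [t < q], some point of [A] precedes [q] and lengthens the
     list by one. *)
  have [r [Dr Fr] rq] : exists2 r, A r & r < t + (q - t).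
    by apply: inf_adherent => //; rewrite subr_gt0.
  move: rq; rewrite subrKC => rq.
  apply: (nl (r :: q :: l)); first by rewrite /= -sl.
  apply: alternating_cons => //; last by apply: alternating_subset al => ? [].
  move=> p; rewrite inE => /orP[/eqP -> //|pl].
  case: al => /= + _; rewrite (path_sortedE lt_trans) =>
    /andP[/allP/(_ _ pl) qp _].
  exact: lt_trans qp.
have ut : u <= t by apply: lb_le_inf; [exists s0|move=> ? [? ?]; exact: uD].
exists (t :: ts); split=> //.
- move=> p; rewrite inE => /orP[/eqP ->|/Hts[tp [s [Ds ts']] ps]].
    by split=> //; exists s0; [case: As0|exact: lt_t].
  by split; [exact: le_trans tp|exists s].
move=> s Ds; rewrite sgn_prod_cons mulrCA.
(* Left of [t], [e * F s] is nonpositive and all remaining factors are nonnegative; right of [t],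
   the factor [t - s] is negative and turns the bound for [- e] into the one for [e]. *)
have [st|ts_|->] := ltgtP s t; last by rewrite subrr mul0r.
  rewrite pmulr_rle0 ?subr_gt0//.
  apply: mulr_le0_ge0.
    by rewrite leNgt; apply/negP => Fs; move: st; rewrite ltNge lt_t.
  rewrite /sgn_prod big_seq; apply: prodr_ge0 => p /Hts[tp _].
  by rewrite subr_ge0 (le_trans (ltW st)).
have := Fts s (conj Ds ts_); rewrite !mulNr oppr_le0 => ge0.
by rewrite nmulr_rle0 // subr_lt0.
Qed.

End Alternation.

(** * Hyperplanes through points of a convex curve *)

Lemma card_le_I T (A : set T) m (c : nat -> T) :
  (forall i, (i < m)%N -> A (c i)) ->
  (forall i j, (i < m)%N -> (j < m)%N -> c i = c j -> i = j) ->
  `I_m #<= A.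
Proof.
move=> Ac injc.
have cI : c @` `I_m #= `I_m.
  by apply: inj_card_eq => i j; rewrite !inE => im jm; apply: injc.
apply: (@card_le_trans _ _ _ (c @` `I_m)); last first.
  by apply: subset_card_le => _ [i im <-]; apply: Ac.
by move: cI; rewrite card_eq_le => /andP[].
Qed.

Section Hyperplane.
Variables (R : realType) (d : nat).
Implicit Types (K : set 'rV[R]_d) (h : 'rV[R]_d * R) (p : 'rV[R]_d).

Definition affine h p : R := \sum_(i < d) h.1 0 i * p 0 i - h.2.

Lemma hyperplaneE h p : hyperplane h p <-> affine h p = 0.
Proof. by rewrite /affine; split=> [->|/subr0_eq //]; rewrite subrr. Qed.

Lemma affine_continuous h : continuous (affine h).
Proof.
have cs : continuous (fun p : 'rV[R]_d => \sum_(i < d) h.1 0 i * p 0 i).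
  apply: continuous_big => [|i _ p]; first exact: add_continuous.
  by apply: continuousM; [exact: cst_continuous|exact: coord_continuous].
by move=> p; apply: (continuousB (cs p)); exact: cst_continuous.
Qed.

Lemma affine_continuousl p : continuous (fun h => affine h p).
Proof.
have cs : continuous (fun h : 'rV[R]_d * R => \sum_(i < d) h.1 0 i * p 0 i).
  apply: continuous_big => [|i _ h]; first exact: add_continuous.
  apply: continuousM; last exact: cst_continuous.
  apply: (@continuous_comp _ _ _ fst (fun x : 'rV[R]_d => x 0 i)).
    exact: cvg_fst.
  exact: coord_continuous.
by move=> h; apply: (continuousB (cs h)); exact: cvg_snd.
Qed.

Lemma perturbs_one K h p :
  h.1 != 0 -> K p -> hyperplane h p -> perturbs_to_at_least K h p 1.
Proof.
move=> h0 Kp hp U W Up Wh; exists h; split=> //; first exact: nbhs_singleton.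
apply: (@card_le_I _ _ _ (fun=> p)).
  by move=> i _; split; [split|exact: nbhs_singleton].
by case=> [|//] [].
Qed.

(** Keeping finitely many intersection points, each with a lower bound of its multiplicity, can only
    decrease the total. *)
Lemma sum_perturbs K h (m : 'rV[R]_d -> nat) (ps : seq 'rV[R]_d) :
  (\esum_(p in K `&` hyperplane h) multiplicity K h p <= (d%:R)%:E)%E ->
  uniq ps ->
  (forall p, p \in ps ->
     [/\ K p, hyperplane h p & perturbs_to_at_least K h p (m p)]) ->
  (\sum_(p <- ps) m p <= d)%N.
Proof.
move=> dK ups psm; rewrite -(ler_nat R) -lee_fin; apply: le_trans dK.
apply: esum_ge; exists [set` ps].
  by split; [exact: finite_seq|move=> p /psm[]].
rewrite -fsbig_seq// natr_sum -sumEFin big_seq [leRHS]big_seq.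
apply: lee_sum => p /psm[_ _ pm].
by apply: ereal_sup_ubound; exists (m p).
Qed.

(** At most [d] homogeneous linear conditions on [d + 1] coefficients have a nonzero solution. Only
    the pair is known to be nonzero here; that [h.1] is nonzero is deduced later from the presence
    of a zero. *)
Lemma exists_affine (ps : seq 'rV[R]_d) : (size ps <= d)%N ->
  exists2 h : 'rV[R]_d * R, h != 0 & forall p, p \in ps -> affine h p = 0.
Proof.
move=> sps.
(* Column [j] is the [j]-th point followed by [-1], so the left kernel consists of the coefficient
   pairs vanishing at all the points. *)
pose A : 'M[R]_(d + 1, size ps) :=
  \matrix_(i, j) (row_mx (tnth (in_tuple ps) j) (-1)%:M : 'rV_(d + 1)) 0 i.
have AE i j :
    A i j = (row_mx (tnth (in_tuple ps) j) (-1)%:M : 'rV_(d + 1)) 0 i.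
  by rewrite mxE.
have : kermx A != 0.
  rewrite -mxrank_eq0 mxrank_ker subn_eq0 -ltnNge.
  by apply: leq_ltn_trans (rank_leq_col _) _; rewrite addn1.
move/rowV0Pn => [v /sub_kermxP vA v0].
exists (lsubmx v, rsubmx v 0 0).
  apply: contra v0; rewrite -pair_eqE /= => /andP[/eqP l0 /eqP r0].
  rewrite -(hsubmxK v) l0.
  have -> : rsubmx v = 0 by apply/rowP => i; rewrite ord1 r0 !mxE.
  by rewrite row_mx0.
move=> p; rewrite -index_mem => ip.
have := congr1 (fun B : 'rV_(size ps) => B 0 (Ordinal ip)) vA.
rewrite [in X in X -> _]mxE mxE big_split_ord /= big_ord1 => <-.
rewrite /affine /=; congr (_ + _).
  apply: eq_bigr => i _.
  by rewrite AE row_mxEl mxE (tnth_nth 0) /= nth_index -?index_mem.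
by rewrite AE row_mxEr !mxE mulrN1.
Qed.
End Hyperplane.

Lemma ball_nbhs (R : realType) (s : R) (A : R -> Prop) :
  (\forall r \near s, A r) ->
  exists2 e : R, 0 < e & forall r, s - e < r < s + e -> A r.
Proof.
move=> /nbhs_ballP[e /= e0 eA]; exists e => // r re; apply: eA.
by rewrite /ball /= distrC real_ltr_distl ?num_real.
Qed.

(** * Constancy of a local sign on an interval *)

Section LocalSign.
Variable R : realType.
Implicit Types (psi : R -> R) (I : set R) (ts : seq R).

Lemma near_right_notin (t : R) ts : \forall r \near t^'+, r \notin ts.
Proof.
elim: ts => [|a ts IH]; first exact: nearW.
have ra : \forall r \near t^'+, r != a.
  have [at_|ta] := leP a t; near=> r.
    by rewrite gt_eqF// (le_lt_trans at_)//; near: r; exact: nbhs_right_gt.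
  by rewrite lt_eqF//; near: r; exact: (nbhs_right_lt ta).
by near=> r; rewrite inE negb_or; apply/andP; split; near: r.
Unshelve. all: by end_near. Qed.

Lemma near_right_nbhs (t : R) (P : R -> Prop) :
  (\forall r \near t, P r) -> \forall r \near t^'+, P r.
Proof. by move=> tP; apply: filterS tP. Qed.

(** Otherwise the points near which [psi] is positive off [ts] and those near which it is negative
    off [ts] would separate the connected set [I]. *)
Lemma locally_signed psi I ts : is_interval I ->
  (forall s, I s -> exists2 e : R, e != 0 &
     \forall r \near s, r \notin ts -> 0 < e * psi r) ->
  exists2 e : R, e != 0 & forall s, I s -> s \notin ts -> 0 < e * psi s.
Proof.
move=> /connected_intervalP/connectedP cI loc.
pose E (b : bool) := [set s | I s /\
  \forall r \near s, r \notin ts -> 0 < (-1) ^+ b * psi r].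
have IE s : I s -> exists b, E b s.
  move=> Is; have [e e0 es] := loc s Is; exists (e < 0); split=> //.
  apply: filterS es => r + rts => /(_ rts).
  case: (ltgtP e 0) e0 => //= e0 _.
    by rewrite nmulr_rgt0// expr1 mulN1r oppr_gt0.
  by rewrite pmulr_rgt0// expr0 mul1r.
(* Points outside the finite list [ts] lie arbitrarily close to [s], so two local signs at [s]
   agree. *)
have Edisj (s : R) (b c : bool) :
    (\forall r \near s, r \notin ts -> 0 < (-1) ^+ b * psi r) ->
    (\forall r \near s, r \notin ts -> 0 < (-1) ^+ c * psi r) -> b = c.
  move=> sb sc.
  have [r [rts [/(_ rts) + /(_ rts)]]] := filter_ex (filterI
    (near_right_notin s ts) (filterI (near_right_nbhs sb) (near_right_nbhs
      sc))).
  by case: b c {sb sc} => [] [];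
    rewrite // ?expr0 ?expr1 ?mul1r ?mulN1r ?oppr_gt0;
    case: (ltgtP (psi r) 0).
have sepE (b c : bool) (s : R) : closure (E b) s -> E c s -> b = c.
  move=> clb [_ sc].
  have [q [[_ qb] qc]] := clb _ (nbhs_interior sc).
  exact: Edisj qb qc.
have [[[u Eu] [v Ev]]|nEE] := pselect (E false !=set0 /\ E true !=set0).
  exfalso; apply: (cI E); split.
  - by case; [exists v|exists u].
  - apply/seteqP; split=> [s /IE[[] Es]|s [[]|[]]//]; by [right|left].
  - split; apply/seteqP; split=> // s [].
      by move=> /sepE cl /cl.
    by move=> Es /sepE/(_ Es).
have [b Eb] : exists b, E b = set0.
  by have [e0|/nonemptyPn ?] := pselect (E false !=set0); [exists true;
    apply/nonemptyPn => e1; apply: nEE|exists false].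
exists ((-1) ^+ ~~ b); first by rewrite signr_eq0.
move=> s Is sts; have [c [Ec1 Ec2]] := IE s Is.
have bc : b <> c by move=> bc; have : E b s by [rewrite bc; split]; rewrite Eb.
have <- : c = ~~ b by case: (b) (c) bc => [] [].
exact: (nbhs_singleton Ec2).
Qed.

End LocalSign.

(** * Affine functions along an arc of [K] parametrized by an open interval *)

Section Curve.
Variables (R : realType) (d : nat) (K : set 'rV[R]_d).
Variables (I : set R) (x : R -> 'rV[R]_d).
Hypothesis convK : forall h : 'rV[R]_d * R, h.1 != 0 ->
  (\esum_(p in K `&` hyperplane h) multiplicity K h p <= (d%:R)%:E)%E.
Hypotheses (oI : open I) (itvI : is_interval I).
Hypotheses (cx : forall s, I s -> {for s, continuous x}) (injx : set_inj I x).
Hypothesis xK : forall s, I s -> K (x s).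
Implicit Types (h : 'rV[R]_d * R) (ts : seq R).

Lemma affine_curve_continuous h s : I s -> {for s, continuous (affine h \o x)}.
Proof.
move=> Is; apply: (@continuous_comp _ _ _ x (affine h) s (cx Is)).
exact: affine_continuous.
Qed.

(** If the affine function has the same sign on both sides of its zero, a small parallel shift
    towards that sign is crossed once on each side, by the intermediate value theorem. *)
Lemma touching_perturbs h t : I t -> h.1 != 0 -> affine h (x t) = 0 ->
  (forall e, 0 < e -> exists r s, [/\ t - e < r < t, t < s < t + e &
    0 < affine h (x r) * affine h (x s)]) ->
  perturbs_to_at_least K h (x t) 2.
Proof.
move=> It h0 ht0 near_t U W Ut Wh.
have [e /= e0 eU] : exists2 e : R, 0 < e &
    forall s, t - e < s < t + e -> I s /\ U (x s).
  apply: ball_nbhs.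
  by apply: filterI; [exact: (open_nbhs_nbhs (conj oI It))|exact: (cx It)].
have [r [s [/andP[er rt] /andP[ts se] rs]]] := near_t e e0.
have [c /= c0 cW] : exists2 c : R, 0 < c &
    forall a, `|a| < c -> W (h.1, h.2 + a).
  case: Wh => -[A B] /= [hA /nbhs_ballP[c /= c0 cB]] AB.
  exists c => // a ac; apply: AB; split=> /=; first exact: nbhs_singleton.
  by apply: cB; rewrite /ball /= opprD addNKr normrN.
set phi := fun s => affine h (x s).
(* Below [c], the shifted hyperplane stays in [W]; below both absolute values, its level is reached
   between [r] and [t] and between [t] and [s]. *)
pose m := Num.min (c / 2) (Num.min `|phi r| `|phi s|).
have m0 : 0 < m.
  by rewrite !lt_min divr_gt0//= !normr_gt0 -negb_or -mulf_eq0 gt_eqF.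
have mc : m < c.
  by rewrite gt_min; apply/orP; left; rewrite ltr_pdivrMr// ltr_pMr// ltr1n.
have mr : m <= `|phi r| by rewrite !ge_min lexx orbT.
have ms : m <= `|phi s| by rewrite !ge_min lexx !orbT.
clearbody m.
pose a := if 0 < phi r then m else - m.
have na : `|a| = m by rewrite /a; case: ifP; rewrite ?normrN gtr0_norm.
have Itv u v : t - e < u -> u <= v -> v < t + e -> {within `[u, v],
  continuous phi}.
  move=> eu uv ve; apply: continuous_in_subspaceT => w.
  rewrite inE /= in_itv /= => /andP[uw wv].
  apply: affine_curve_continuous; apply: (eU _ _).1.
  by rewrite (lt_le_trans eu)//= (le_lt_trans wv).
have et : t - e < t by rewrite ltrBlDr ltrDl.
have te : t < t + e by rewrite ltrDl.
have phit : phi t = 0 by [].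
have [u uI phiu] : exists2 u, u \in `[r, t] & phi u = a.
  apply: IVT; [exact: ltW|exact: Itv (ltW _) _|].
  rewrite phit /a; move: mr; have [r0 mr|r0 mr] := ltP 0 (phi r).
    rewrite gtr0_norm// in mr.
    by rewrite (ltW m0) mr.
  rewrite ler0_norm// in mr.
  by rewrite lerNr mr oppr_le0 ltW.
have [v vI phiv] : exists2 v, v \in `[t, s] & phi v = a.
  apply: IVT; [exact: ltW|exact: Itv (ltW _) _|].
  rewrite phit /a; move: rs ms; rewrite -/(phi r) -/(phi s).
  have [r0 rs ms|r0 rs ms] := ltP 0 (phi r).
    rewrite pmulr_rgt0// in rs; rewrite gtr0_norm// in ms.
    by rewrite ge_min (ltW m0) le_max ms orbT.
  have s0 : phi s < 0.
    by move: rs; case: (ltgtP 0 (phi s)) => //; [move=> ?;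
      rewrite ltNge mulr_le0_ge0// ltW|move=> <-; rewrite mulr0 ltxx].
  rewrite ltr0_norm// lerNr in ms.
  by rewrite ge_min ms le_max oppr_le0 (ltW m0) orbT.
have a0 : a != 0 by rewrite -normr_gt0 na.
have ut : u < t.
  move: uI; rewrite in_itv /= => /andP[_]; rewrite le_eqVlt => /orP[/eqP ut|//].
  by move: a0; rewrite -phiu ut phit eqxx.
have tv : t < v.
  move: vI; rewrite in_itv /= => /andP[+ _];
    rewrite le_eqVlt => /orP[/eqP tv|//].
  by move: a0; rewrite -phiv -tv phit eqxx.
move: uI vI; rewrite !in_itv /= => /andP[ru _] /andP[_ vs].
have [Iu Uu] : I u /\ U (x u).
  by apply: eU; rewrite (lt_le_trans er)//= (lt_trans ut).
have [Iv Uv] : I v /\ U (x v).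
  by apply: eU; rewrite (lt_trans et)//= (le_lt_trans vs).
have onH w : phi w = a -> hyperplane (h.1, h.2 + a) (x w).
  by move=> ?; apply/hyperplaneE;
    rewrite /affine /= opprD addrA -/(affine h (x w)) -/(phi w); apply/eqP;
      rewrite subr_eq0; apply/eqP.
exists (h.1, h.2 + a); split=> //; first by apply: cW; rewrite na.
have uv : x u <> x v.
  by move=> /(injx (mem_set Iu) (mem_set Iv)) uv; move: (lt_trans ut tv);
    rewrite uv ltxx.
apply: (@card_le_I _ _ _ (fun i => if i is 0 then x u else x v)).
  by case=> [|[]] // _; split=> //; split; (exact: xK || exact: onH).
by case=> [|[|//]] [|[|//]] // _ _ // /esym.
Qed.

(** A nonzero [h] with [h.1 = 0] is a nonzero constant and has no zeros; otherwise every zero counts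
    at least once in the sum of multiplicities. *)
Lemma affine_curve_zeros h ts : (0 < d)%N -> h != 0 -> uniq ts ->
  (forall t, t \in ts -> I t /\ affine h (x t) = 0) ->
  (size ts <= d)%N /\ forall t, t \in ts -> h.1 != 0.
Proof.
move=> d0 h0 uts tsh.
have [h10|h10] := eqVneq h.1 0.
  case: ts uts tsh => // t ts _ /(_ t (mem_head _ _))[It].
  rewrite /affine h10 => /eqP; rewrite big1 ?sub0r => [|i _];
    last by rewrite mxE mul0r.
  by rewrite oppr_eq0 => h20; case/negP: h0; rewrite -pair_eqE /= h10 eqxx.
split=> //; have : (\sum_(p <- map x ts) 1 <= d)%N.
  apply: (@sum_perturbs _ _ K h (fun=> 1)); first exact: convK.
    by rewrite map_inj_in_uniq// => s t /tsh[Is _] /tsh[It _]; apply: injx;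
      rewrite inE.
  move=> _ /mapP[t /tsh[It ht] ->].
  by have ? := (hyperplaneE _ _).2 ht; split=> //;
    [exact: xK|apply: perturbs_one => //; exact: xK].
by rewrite sum1_size size_map.
Qed.

(** The affine function through the [d] points changes sign exactly where [sgn_prod ts] does, so
    their product has constant sign; replacing [h] by [- h] makes it nonnegative. *)
Lemma interpolating_affine ts : (0 < d)%N -> uniq ts -> size ts = d ->
  (forall t, t \in ts -> I t) ->
  exists h, [/\ h != 0,
    (forall s, I s -> affine h (x s) = 0 -> s \in ts),
    (forall s, s \in ts -> affine h (x s) = 0) &
    forall s, I s -> 0 <= affine h (x s) * sgn_prod ts s].
Proof.
move=> d0 uts sts tsI.
have [h h0 hts] : exists2 h : 'rV[R]_d * R, h != 0 &
    forall p, p \in map x ts -> affine h p = 0.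
  by apply: exists_affine; rewrite size_map sts.
have ht t : t \in ts -> affine h (x t) = 0 by move=> ?; apply/hts/map_f.
have h10 : h.1 != 0.
  have [_ nz] := affine_curve_zeros d0 h0 uts (fun t tts =>
    conj (tsI t tts) (ht t tts)).
  by case: ts sts nz {uts tsI hts ht} =>
    [|t ts _ /(_ t (mem_head _ _)) //] /= dd; rewrite -dd in d0.
have hz s : I s -> affine h (x s) = 0 -> s \in ts.
  move=> Is hs; apply: contraT => sts'.
  (* Another zero besides the [d] points would be one too many. *)
  have [] := @affine_curve_zeros h (s :: ts) d0 h0.
  - by rewrite /= sts'.
  - by move=> t; rewrite inE => /orP[/eqP -> //|tts]; split;
    [exact: tsI|exact: ht].
  - by rewrite /= sts ltnn.
pose phi s := affine h (x s).
(* Without a weak sign change at [t], the multiplicity there would be at least 2 and the total at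
   least [d + 1]. *)
have sep t : t \in ts -> exists2 e : R, 0 < e &
    forall r s, t - e < r < t -> t < s < t + e -> phi r * phi s <= 0.
  move=> tts; apply: contrapT => nsep.
  have It := tsI _ tts.
  have pert : perturbs_to_at_least K h (x t) 2.
    apply: touching_perturbs => //; first exact: ht.
    move=> e e0; apply: contrapT => nrs; apply: nsep; exists e => // r s rt ts'.
    by rewrite leNgt; apply/negP => rs; apply: nrs; exists r, s.
  have : (\sum_(p <- map x ts) (if p == x t then 2 else 1) <= d)%N.
    apply: (@sum_perturbs _ _ K h (fun p => if p == x t then 2 else 1)%N).
    - exact: convK.
    - by rewrite map_inj_in_uniq// => r s /tsI Ir /tsI Is; apply: injx;
      rewrite inE.
    move=> _ /mapP[s sts' ->]; have Is := tsI _ sts'.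
    have hs := (hyperplaneE _ _).2 (ht _ sts').
    split=> //; first exact: xK.
    case: eqP => [-> //|_]; apply: perturbs_one => //; exact: xK.
  rewrite big_map (big_rem t)//= eqxx.
  have : (\sum_(s <- rem t ts) 1 <= \sum_(s <- rem t ts) if x s == x t then 2
    else 1)%N.
    by apply: leq_sum => s _; case: ifP.
  rewrite sum1_size size_rem// sts => le1 le2.
  by have := leq_trans (leq_add (leqnn 2) le1) le2; rewrite add2n prednK// ltnn.
pose psi s := phi s * sgn_prod ts s.
have near_sgn (g : R -> R) s : {for s, continuous g} -> g s != 0 ->
    \forall r \near s, 0 < g s * g r.
  move=> cg gs0; have cgg : {for s, continuous (fun r => g s * g r)}.
    exact: (continuousM (@cst_continuous _ _ (g s) s) cg).
  by apply: (cvgr_gt _ cgg); rewrite -expr2 exprn_even_gt0.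
have [e e0 epsi] : exists2 e : R, e != 0 & forall s,
  I s -> s \notin ts -> 0 < e * psi s.
  apply: locally_signed => // s Is.
  have [sts'|sts'] := boolP (s \in ts); last first.
    exists (psi s).
      by rewrite mulf_neq0 ?sgn_prod_neq0//; apply: contraNneq sts' => /hz ->.
    near=> r; move=> _; near: r; apply: near_sgn.
      by apply: continuousM; [exact: affine_curve_continuous|exact:
        sgn_prod_continuous].
    by rewrite mulf_neq0 ?sgn_prod_neq0//; apply: contraNneq sts' => /hz ->.
  have [e e0 es] := sep s sts'.
  (* The factors other than [s - r] keep the sign of [c] near [s], so only the sign of
     [phi r * (s - r)] is at stake. *)
  pose us := rem s ts; pose c := sgn_prod us s.
  have c0 : c != 0 by apply: sgn_prod_neq0; rewrite mem_rem_uniq// inE eqxx.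
  have psiE r : psi r = phi r * ((s - r) * sgn_prod us r).
    by rewrite /psi /sgn_prod (big_rem s).
  have [e1 e10 e1I] : exists2 e1 : R, 0 < e1 & forall r, s - e1 < r < s + e1 ->
      I r /\ 0 < c * sgn_prod us r.
    apply: ball_nbhs; apply: filterI;
      first exact: (open_nbhs_nbhs (conj oI Is)).
    by apply: (near_sgn (sgn_prod us)) => //; exact: sgn_prod_continuous.
  pose e2 := Num.min e e1.
  have e20 : 0 < e2 by rewrite lt_min e0.
  have inI r : s - e2 < r < s + e2 -> I r /\ 0 < c * sgn_prod us r.
    move=> /andP[r1 r2]; apply: e1I;
      rewrite (le_lt_trans _ r1) ?(lt_le_trans r2)//.
      by rewrite lerD2l ge_min lexx orbT.
    by rewrite lerD2l lerN2 ge_min lexx orbT.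
  have opp r1 r2 : s - e2 < r1 < s -> s < r2 < s + e2 ->
      r1 \notin ts -> r2 \notin ts -> phi r1 * phi r2 < 0.
    move=> /andP[a1 a2] /andP[b1 b2] r1ts r2ts.
    have I1 : I r1 by apply: (inI _ _).1; rewrite a1 (lt_trans a2)// ltrDl.
    have I2 : I r2 by apply: (inI _ _).1;
      rewrite b2 andbT (lt_trans _ b1)// ltrBlDr ltrDl.
    rewrite lt_neqAle mulf_neq0 /=.
    - apply: es; rewrite ?a2 ?b1 ?andbT /=.
        by apply: le_lt_trans a1; rewrite lerD2l lerN2 ge_min lexx.
      by apply: (lt_le_trans b2); rewrite lerD2l ge_min lexx.
    - by apply: contraNneq r1ts => /hz ->.
    - by apply: contraNneq r2ts => /hz ->.
  have pick a b : a < b -> exists2 r, a < r < b & r \notin ts.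
    move=> ab; have /filter_ex[r [ra [rb rts]]] : \forall r \near a^'+,
      a < r /\ r < b /\ r \notin ts.
      near=> r; split; [|split].
      - by near: r; exact: nbhs_right_gt.
      - by near: r; exact: (nbhs_right_lt ab).
      - by near: r; exact: near_right_notin.
    by exists r; rewrite ?ra.
  have [r1 r1s r1ts] : exists2 r, s - e2 < r < s & r \notin ts.
    by apply: pick; rewrite ltrBlDr ltrDl.
  have [r2 r2s r2ts] : exists2 r, s < r < s + e2 & r \notin ts.
    by apply: pick; rewrite ltrDl.
  have r12 := opp _ _ r1s r2s r1ts r2ts.
  (* The point [r1] left of [s] fixes the sign: [phi r] agrees with [phi r1] on the left of [s], by
     comparison of both with [r2], and is opposite to it on the right. *)
  exists (phi r1 * c).
    by rewrite mulf_neq0//; move: r12; apply: contraTneq => ->;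
      rewrite mul0r ltxx.
  have : \forall r \near s, s - e2 < r < s + e2.
    apply/nbhs_ballP; exists e2 => //= r.
    by rewrite /ball /= distrC real_ltr_distl ?num_real.
  apply: filterS => r re rts; have [_ cr] := inI _ re.
  rewrite psiE.
  have -> : phi r1 * c * (phi r * ((s - r) * sgn_prod us r)) =
    (phi r1 * phi r * (s - r)) * (c * sgn_prod us r) by ring.
  rewrite pmulr_lgt0//; move: re => /andP[re1 re2].
  have [rs|sr|rs] := ltgtP r s.
  - rewrite pmulr_lgt0 ?subr_gt0//.
    have rr2 : phi r * phi r2 < 0 by apply: opp => //; rewrite re1.
    have : 0 < (phi r1 * phi r2) * (phi r * phi r2) by rewrite nmulr_rgt0.
    have -> : (phi r1 * phi r2) * (phi r * phi r2) = (phi r1 * phi r) * (phi r2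
      ^+ 2).
      by ring.
    by rewrite pmulr_lgt0// exprn_even_gt0//=; apply: contraTneq rr2 => ->;
      rewrite mulr0 ltxx.
  - by rewrite nmulr_lgt0 ?subr_lt0//; apply: opp => //; rewrite sr.
  - by move: rts; rewrite rs sts'.
have [eps|eneg] := ltP 0 e.
  exists h; split=> // s Is.
  have [sts'|sts'] := boolP (s \in ts); first by rewrite ht// mul0r.
  by have := epsi s Is sts'; rewrite pmulr_rgt0// => /ltW.
have {}eneg : e < 0 by rewrite lt_neqAle e0.
have affN p : affine (- h) p = - affine h p.
  rewrite /affine /= opprB opprK addrC -sumrN; congr (_ + _).
  by apply: eq_bigr => i _; rewrite mxE mulNr.
exists (- h); split; first by rewrite oppr_eq0.
- by move=> s Is /eqP; rewrite affN oppr_eq0 => /eqP; exact: hz.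
- by move=> s sts'; rewrite affN ht// oppr0.
move=> s Is; rewrite affN mulNr oppr_ge0.
have [sts'|sts'] := boolP (s \in ts); first by rewrite ht// mul0r.
by have := epsi s Is sts'; rewrite nmulr_rgt0// => /ltW.
Unshelve. all: by end_near. Qed.

End Curve.

(** * Affine functions with prescribed weak signs *)

Section Perturbation.
Variable R : realType.
Implicit Types (I : set R) (ts S : seq R).

Lemma near_right_same_side (t : R) S :
  \forall r \near t^'+, forall s, s \in S -> s != t -> 0 < (t - s) * (r - s).
Proof.
elim: S => [|a S IH]; first exact: nearW.
have ra : \forall r \near t^'+, a != t -> 0 < (t - a) * (r - a).
  have [at_|ta|->] := ltgtP a t; last by apply: nearW => r; rewrite ?eqxx.
    by apply: filterS (nbhs_right_gt t) => r tr _;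
      rewrite mulr_gt0// subr_gt0// (lt_trans at_).
  by apply: filterS (nbhs_right_lt ta) => r ra _; rewrite nmulr_rgt0 subr_lt0.
apply: filterS2 ra IH => r ra IH s; rewrite inE => /orP[/eqP -> //|]; exact: IH.
Qed.

Lemma interval_ub I S : I !=set0 -> (forall s, s \in S -> I s) ->
  exists2 t, I t & forall s, s \in S -> s <= t.
Proof.
move=> [t0 It0]; elim: S => [|a S IH] SI; first by exists t0.
have [s sS|t It St] := IH; first by apply: SI; rewrite inE sS orbT.
have [at_|ta] := leP a t.
  by exists t => // s; rewrite inE => /orP[/eqP ->|/St].
exists a; first by apply: SI; rewrite mem_head.
by move=> s; rewrite inE => /orP[/eqP ->//|/St/le_trans]; apply; exact: ltW.
Qed.

(** Each point of [ts] is moved slightly to the right, past no point of [S], to make the points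
    distinct; missing points are added to the right of [S], where their factors are positive. *)
Lemma sgn_prod_perturb I S ts m : open I -> I !=set0 ->
  (forall s, s \in S -> I s) -> (forall t, t \in ts -> I t) ->
  (size ts <= m)%N ->
  exists ts', [/\ uniq ts', size ts' = m, (forall t, t \in ts' -> I t) &
    forall s, s \in S -> sgn_prod ts s != 0 ->
      0 < sgn_prod ts s * sgn_prod ts' s].
Proof.
move=> oI I0 SI; elim: m ts => [|m IH] ts tsI.
  rewrite leqn0 size_eq0 => /eqP ->; exists [::]; split=> // s _ _.
  by rewrite /sgn_prod big_nil mulr1.
case: ts tsI => [tsI _|t ts tsI /= sts].
  have [ts' [uts' sts' tsI' ts'S]] := IH [::] tsI isT.
  have [t It St] := interval_ub I0 SI.
  have /filter_ex[r [rt [rI rts]]] :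
      \forall r \near t^'+, t < r /\ I r /\ r \notin ts'.
    apply: filterI; first exact: nbhs_right_gt.
    apply: filterI; last exact: near_right_notin.
    exact: near_right_nbhs (open_nbhs_nbhs (conj oI It)).
  exists (r :: ts'); split; rewrite /= ?rts ?sts'//.
    by move=> p; rewrite inE => /orP[/eqP ->|/tsI'].
  move=> s sS /(ts'S s sS) ts0; rewrite sgn_prod_cons mulrCA mulr_gt0//.
  by rewrite subr_gt0 (le_lt_trans (St s sS)).
have [||ts' [uts' sts' tsI' ts'S]] := IH ts.
- by move=> p pts; apply: tsI; rewrite inE pts orbT.
- by [].
have It : I t by apply: tsI; rewrite mem_head.
have /filter_ex[r [rS [rI rts]]] : \forall r \near t^'+,
    (forall s, s \in S -> s != t -> 0 < (t - s) * (r - s)) /\ I r /\ r \notin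
      ts'.
  apply: filterI; first exact: near_right_same_side.
  apply: filterI; last exact: near_right_notin.
  exact: near_right_nbhs (open_nbhs_nbhs (conj oI It)).
exists (r :: ts'); split; rewrite /= ?rts ?sts'//.
  by move=> p; rewrite inE => /orP[/eqP ->|/tsI'].
(* The case [s = t], where moving [t] creates a sign, is excluded since [sgn_prod] vanishes
   there. *)
move=> s sS; rewrite !sgn_prod_cons mulf_eq0 negb_or subr_eq0 eq_sym =>
  /andP[st s0].
rewrite mulrACA mulr_gt0//; first exact: rS.
exact: ts'S.
Qed.

End Perturbation.

(** * Compactness of the normalized coefficients *)

Section Sphere.
Variables (R : realType) (d : nat).

Lemma affineZ (a : R) (h : 'rV[R]_d * R) p : affine (a *: h) p = a * affine h p.
Proof.
rewrite /affine /= mulrBr mulr_sumr; congr (_ - _).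
by apply: eq_bigr => i _; rewrite mxE mulrA.
Qed.

(** The norm of a pair is the maximum of the two norms, so the sphere is closed in a product of two
    compact balls. *)
Lemma unit_sphere_compact : compact [set h : 'rV[R]_d * R | `|h| = 1].
Proof.
have cB : compact ([set v : 'rV[R]_d | `|v| <= 1] `*` [set a : R | `|a| <= 1]).
  apply: compact_setX.
    apply: bounded_closed_compact.
      by exists 1; split; [exact: num_real|move=> M M1 v /= /le_trans]; apply;
        exact: ltW.
    apply: (@preimage_closed _ _ (fun v : 'rV[R]_d => `|v|) [set y | y <= 1]).
      by move=> v _; exact: norm_continuous.
    exact: closed_le.
  have -> : [set a : R | `|a| <= 1] = `[-1, 1]%classic.
    by apply/seteqP; split=> a /=; rewrite in_itv /= ler_norml.
  exact: segment_compact.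
apply: (subclosed_compact _ cB).
  apply: (@preimage_closed _ _ (fun v : 'rV[R]_d * R => `|v|) [set y | y = 1]).
    by move=> v _; exact: norm_continuous.
  exact: closed_eq.
move=> [v a] /= va; split=> /=; by rewrite -va prod_normE /= le_max lexx ?orbT.
Qed.

End Sphere.

(* compact_In0 is only stated for ptopologicalType. *)
HB.instance Definition _ (T U : ptopologicalType) := Pointed.on (T * U)%type.

Section Interpolation.
Variables (R : realType) (d : nat) (K : set 'rV[R]_d).
Variables (I : set R) (x : R -> 'rV[R]_d).
Hypothesis convK : forall h : 'rV[R]_d * R, h.1 != 0 ->
  (\esum_(p in K `&` hyperplane h) multiplicity K h p <= (d%:R)%:E)%E.
Hypotheses (oI : open I) (itvI : is_interval I) (I0 : I !=set0).
Hypotheses (cx : forall s, I s -> {for s, continuous x}) (injx : set_inj I x).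
Hypothesis xK : forall s, I s -> K (x s).
Hypothesis d0 : (0 < d)%N.
Implicit Types (h : 'rV[R]_d * R) (ts : seq R).

(* By compactness only finitely many s need to be treated at once, and for these
   ts may be replaced by d distinct points. *)
Lemma weakly_interpolating_affine ts : (size ts <= d)%N ->
  (forall t, t \in ts -> I t) ->
  exists2 h, h != 0 & forall s, I s -> 0 <= affine h (x s) * sgn_prod ts s.
Proof.
move=> sts tsI.
pose S := [set h : 'rV[R]_d * R | `|h| = 1].
pose C s := [set h | 0 <= affine h (x s) * sgn_prod ts s].
have closedC s : closed (C s).
  apply: (@preimage_closed _ _ (fun h =>
    affine h (x s) * sgn_prod ts s) [set y | 0 <= y]).
    move=> h _; apply: (@continuousM _ _ (fun h => affine h (x s)) (cst _) h).
      exact: affine_continuousl.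
    exact: cst_continuous.
  exact: closed_ge.
(* Compactness is used as the finite intersection property for the closed conditions [C s] on the
   sphere. *)
have /= cS := congr1 (fun F => F S) (@compact_In0 ('rV[R]_d * R)%type).
have := @unit_sphere_compact R d; rewrite -/S cS.
case/(_ R I (fun s => S `&` C s)).
- by exists C.
- move=> D DI.
  have [ts' [uts' sts' tsI' ts'D]] : exists ts', [/\ uniq ts', size ts' = d,
      (forall t, t \in ts' -> I t) &
      forall s, s \in finmap.enum_fset D -> sgn_prod ts s != 0 ->
        0 < sgn_prod ts s * sgn_prod ts' s].
    by apply: sgn_prod_perturb => // s /DI; rewrite inE.
  have [h [h0 _ _ hP]] := interpolating_affine convK oI itvI cx injx xK d0 uts'
    sts' tsI'.
  exists (`|h|^-1 *: h) => s Ds; split; first exact: normfZV.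
  rewrite /C /= affineZ -mulrA mulr_ge0 ?invr_ge0//.
  have [->|nz] := eqVneq (sgn_prod ts s) 0; first by rewrite mulr0.
  have Is : I s by have := DI s Ds; rewrite inE.
  have PP := ts'D s Ds nz.
  have P'0 : sgn_prod ts' s != 0 by apply: contraTneq PP => ->;
    rewrite mulr0 ltxx.
  have := hP s Is.
  (* Multiplying by the positive product of the two patterns replaces [ts'] by [ts], up to a
     positive square. *)
  rewrite -(pmulr_lge0 (affine h (x s) * sgn_prod ts' s) PP).
  have -> : affine h (x s) * sgn_prod ts' s * (sgn_prod ts s * sgn_prod ts' s) =
    affine h (x s) * sgn_prod ts s * sgn_prod ts' s ^+ 2 by ring.
  by rewrite pmulr_lge0// exprn_even_gt0.
(* The norm of [h] is read off from any one member of the family, whence the need for a point of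
   [I]. *)
move=> h hC; have [s0 Is0] := I0.
exists h; last by move=> s Is; have [] := hC s Is.
by have [+ _] := hC s0 Is0; rewrite /S /= => h1;
  rewrite -normr_eq0 h1 oner_neq0.
Qed.

(** The list is cut into [n] blocks of at most [d] points, with one affine function for each
    block. *)
Lemma interpolating_product n ts : (size ts <= d * n)%N ->
  (forall t, t \in ts -> I t) ->
  exists hs : seq ('rV[R]_d * R), [/\ size hs = n, (forall h,
    h \in hs -> h != 0) &
    forall s, I s -> 0 <= (\prod_(h <- hs) affine h (x s)) * sgn_prod ts s].
Proof.
elim: n ts => [|n IH] ts.
  rewrite muln0 leqn0 size_eq0 => /eqP -> _; exists [::]; split=> // s _.
  by rewrite /sgn_prod !big_nil mulr1.
move=> sts tsI.
have [|t /mem_take /tsI //|h h0 hP] := @weakly_interpolating_affine (take d ts).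
  by rewrite size_take_min geq_minl.
have [|t /mem_drop /tsI //|hs [shs hs0 hsP]] := IH (drop d ts).
  by rewrite size_drop leq_subLR -mulnS.
exists (h :: hs); split; first by rewrite /= shs.
  by move=> g; rewrite inE => /orP[/eqP -> //|/hs0].
move=> s Is; rewrite /sgn_prod -(cat_take_drop d ts) big_cat big_cons /=.
by rewrite mulrACA mulr_ge0//; [exact: hP|exact: hsP].
Qed.

(** Each factor has at most [d] zeros along the arc: an infinite zero set would contain [d + 1]
    distinct ones. *)
Lemma affine_product_zeros (hs : seq ('rV[R]_d * R)) :
  (forall h, h \in hs -> h != 0) ->
  exists Z : seq R, forall s,
    I s -> \prod_(h <- hs) affine h (x s) = 0 -> s \in Z.
Proof.
elim: hs => [_|h hs IH hs0].
  by exists [::] => s _ /eqP; rewrite big_nil oner_eq0.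
have [|Z HZ] := IH; first by move=> g ghs; apply: hs0; rewrite inE ghs orbT.
have h0 : h != 0 by apply: hs0; rewrite mem_head.
pose A := [set s | I s /\ affine h (x s) = 0].
have [/finite_seqP[Z' AZ']|] := pselect (finite_set A); last first.
  move=> Ainf; have [B BA dB] := infinite_set_fset d.+1 Ainf.
  have [] := affine_curve_zeros convK injx xK d0 h0 (finmap.fset_uniq B).
    by move=> t tB; exact: BA.
  by rewrite leqNgt dB.
exists (Z' ++ Z) => s Is /eqP;
  rewrite big_cons mulf_eq0 mem_cat => /orP[/eqP hs1|/eqP].
  by have : A s by []; rewrite AZ' /= => ->.
by move=> /(HZ s Is) ->; rewrite orbT.
Qed.

End Interpolation.

(** * Orthogonality forces alternation *)

(** A positive value [G s] keeps [G] above [G s / 2] on a short interval, whose contribution to the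
    integral is positive. *)
Lemma continuous_integral0 (R : realType) (I : set R) (G : R -> R) :
  open I -> (forall s, I s -> {for s, continuous G}) ->
  (forall s, I s -> 0 <= G s) ->
  lebesgue_measure.-integrable I (EFin \o G) ->
  (\int[lebesgue_measure]_(s in I) (G s)%:E = 0)%E ->
  forall s, I s -> G s = 0.
Proof.
move=> oI cG G0 iG intG s Is; apply/eqP; rewrite eq_le (G0 s Is) andbT leNgt.
apply/negP => Gs.
have [e e0 eP] : exists2 e : R, 0 < e & forall r, s - e < r < s + e ->
    I r /\ G s / 2 < G r.
  apply: ball_nbhs; apply: filterI; first exact: (open_nbhs_nbhs (conj oI Is)).
  apply: (cvgr_gt _ (cG s Is)).
  by rewrite ltr_pdivrMr// ltr_pMr// ltr1n.
pose J := `]s - e, s + e[%classic : set R.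
have JI : J `<=` I by move=> r; rewrite /J /= in_itv /= => /eP[].
have mI : measurable I by exact: open_measurable.
have mJ : measurable J by exact: measurable_itv.
have mGI : measurable_fun I (EFin \o G) by exact: measurable_int iG.
have : (\int[lebesgue_measure]_(r in J) (cst (G s / 2)%:E r) <=
    \int[lebesgue_measure]_(r in I) (G r)%:E)%E.
  apply: (@le_trans _ _ (\int[lebesgue_measure]_(r in J) (G r)%:E)%E).
    apply: ge0_le_integral => //.
    - by move=> r _; rewrite lee_fin divr_ge0// ltW.
    - exact: measurable_funS mGI.
    - by move=> r; rewrite /J /= in_itv /= => /eP[_ /ltW]; rewrite lee_fin.
  by apply: ge0_subset_integral => // r /G0; rewrite lee_fin.
have -> : (\int[lebesgue_measure]_(r in J) (cst (G s / 2)%:E r) =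
    (G s / 2)%:E * (e + e)%:E)%E.
  rewrite integral_cst//; congr (_ * _)%E.
  transitivity (lebesgue_measure J) => //.
  rewrite /J lebesgue_measure_itv /= lte_fin ifT; last first.
    by rewrite ltrBlDr -addrA ltrDl addr_gt0.
  by rewrite -EFinB opprB addrC addrA subrK.
by rewrite intG -EFinM lee_fin leNgt mulr_gt0 ?divr_gt0 ?addr_gt0.
Qed.

Section Existence.
Variables (R : realType) (d n : nat) (K : set 'rV[R]_d).
Variables (I : set R) (x : R -> 'rV[R]_d) (f : 'rV[R]_d -> R).
Hypothesis convK : forall h : 'rV[R]_d * R, h.1 != 0 ->
  (\esum_(p in K `&` hyperplane h) multiplicity K h p <= (d%:R)%:E)%E.
Hypotheses (oI : open I) (itvI : is_interval I).
Hypotheses (cx : forall s, I s -> {for s, continuous x}) (injx : set_inj I x).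
Hypothesis xK : forall s, I s -> K (x s).
Hypothesis d0 : (0 < d)%N.
Let F := f \o x.
Hypothesis cF : forall s, I s -> {for s, continuous F}.
Hypothesis F0 : exists2 s, I s & F s != 0.
Hypothesis orthF : orthogonal_to_polynomials n I x f.

(** The interpolating product, times [- e], is a polynomial of degree at most [n] whose product with
    [f] is nonnegative. Its integral vanishes, so it is zero everywhere, although both factors are
    nonzero at some common point. *)
Lemma no_sign_pattern (e : R) (ts : seq R) : e != 0 -> (size ts <= d * n)%N ->
  (forall t, t \in ts -> I t) ->
  (forall s, I s -> e * F s * sgn_prod ts s <= 0) -> False.
Proof.
move=> e0 sts tsI ePs.
have I0 : I !=set0 by have [s Is _] := F0; exists s.
have [hs [shs hs0 hsP]] :=
  interpolating_product convK oI itvI I0 cx injx xK d0 sts tsI.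
have [Z HZ] := affine_product_zeros convK injx xK d0 hs0.
have [P] := AffineProduct.affine_product_polynomial hs (- e).
rewrite shs => dP evP.
have {}evP p : MPolynomial.eval P p = - e * \prod_(h <- hs) affine h p := evP p.
have [iG intG] := orthF dP.
pose G s := MPolynomial.eval P (x s) * f (x s).
have GE s : G s = - e * \prod_(h <- hs) affine h (x s) * F s by rewrite /G evP.
have cG s : I s -> {for s, continuous G}.
  move=> Is; have -> : G = (fun s =>
    - e * \prod_(h <- hs) affine h (x s) * F s).
    exact/funext.
  apply: continuousM; last exact: cF.
  apply: continuousM; first exact: cst_continuous.
  apply: cvg_big => [|h _]; first exact: mul_continuous.
  exact: (affine_curve_continuous cx).
have G0 s : I s -> 0 <= G s.
  move=> Is; rewrite leNgt; apply/negP => Gs.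
  (* The weak inequalities say nothing at points of [ts], but a negative value would persist nearby,
     outside [ts]. *)
  have : \forall r \near s, I r /\ G r < 0.
    apply: filterI; first exact: (open_nbhs_nbhs (conj oI Is)).
    exact: (cvgr_lt _ (cG s Is)).
  move=> /near_right_nbhs/(filterI (near_right_notin s ts))/filter_ex[r [rts
    [Ir Gr]]].
  have P0 := sgn_prod_neq0 rts.
  have : 0 <= G r * sgn_prod ts r ^+ 2.
    have -> : G r * sgn_prod ts r ^+ 2 = - ((e * F r * sgn_prod ts r) *
        ((\prod_(h <- hs) affine h (x r)) * sgn_prod ts r)) by rewrite GE; ring.
    by rewrite oppr_ge0 mulr_le0_ge0//; [exact: ePs|exact: hsP].
  by rewrite pmulr_lge0 ?exprn_even_gt0//= leNgt Gr.
have Gz := continuous_integral0 oI cG G0 iG intG.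
have [s Is Fs] := F0.
(* The zeros of the product lie in the finite list [Z], which cannot contain all points near [s]. *)
have : \forall r \near s, I r /\ F r != 0.
  apply: filterI; first exact: (open_nbhs_nbhs (conj oI Is)).
  exact: (cvgr_neq0 _ (cF Is)).
move=> /near_right_nbhs/(filterI (near_right_notin s Z))/filter_ex[r [rZ [Ir
  Fr]]].
case/negP: rZ; apply: HZ => //; apply/eqP.
have /eqP := Gz r Ir.
by rewrite GE !mulf_eq0 oppr_eq0 (negbTE e0) (negbTE Fr) orbF.
Qed.

Lemma alternating_prepend (e : R) s r l : alternating e F I (s :: l) -> I r ->
  r < s -> e * F r < 0 -> alternating (- e) F I (r :: s :: l).
Proof.
move=> al Ir rs er; apply: alternating_cons => //; last by rewrite opprK.
  by rewrite mulNr oppr_gt0.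
move=> p; rewrite inE => /orP[/eqP -> //|pl].
case: al => /= + _; rewrite (path_sortedE lt_trans) =>
  /andP[/allP/(_ _ pl) sp _].
exact: lt_trans sp.
Qed.

(** If all alternating lists were shorter, the longest one would bound the number of sign switches
    of [F] by [d * n], giving a forbidden sign pattern. *)
Lemma exists_alternating :
  exists e : R, exists2 l, size l = (d * n).+2 & alternating e F I l.
Proof.
apply: contrapT => nalt.
pose P k := exists2 e : R, e != 0 & exists2 l, size l = k & alternating e F I l.
have P1 : P 1%N.
  have [s Is Fs] := F0; exists (F s) => //; exists [:: s] => //;
    split=> // -[|//] _ /=.
  by rewrite expr0 mulr1 -expr2 exprn_even_gt0.
have Pn : ~ P (d * n).+2 by move=> [e _ [l ? ?]]; apply: nalt; exists e, l.
(* The maximal length is [k + 1]; the sign of the first value is free in [P]. *)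
have [k [kdn [e e0 [l sl al]] nP]] :
    exists k, [/\ (k <= d * n)%N, P k.+1 & ~ P k.+2].
  elim: (d * n)%N Pn => [|m IH] Pm; first by exists 0%N.
  have [Pm1|/IH[k [km Pk nPk]]] := pselect (P m.+2); first by exists m.+1.
  by exists k; split=> //; exact: leqW.
case: l sl al => // s l [sl] al.
have [Is es] := al.2 0%N isT; rewrite expr0 mulr1 /= in Is es.
have e0' : - e != 0 by rewrite oppr_eq0.
(* With [- e], a point of that sign before [s] could be prepended to [s :: l]. A list of length
   [k + 1] starting with that sign could likewise be prepended by [s], or its head prepended to
   [s :: l]. Both contradict maximality. *)
have [||ts [sts tsI tsP]] := @sign_pattern R k (- e) F I s e0'.
- move=> r Ir; rewrite mulNr oppr_gt0 => er; rewrite leNgt; apply/negP => rs.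
  apply: nP; exists (- e) => //; exists (r :: s :: l); first by rewrite /= sl.
  exact: alternating_prepend.
- case=> // r l' [sl'] al'.
  have [Ir er] := al'.2 0%N isT; rewrite expr0 mulr1 mulNr oppr_gt0 /= in Ir er.
  have [rs|sr|rs] := ltgtP r s.
  + apply: nP; exists (- e) => //; exists (r :: s :: l); first by rewrite /= sl.
    exact: alternating_prepend.
  + apply: nP; exists e => //; exists (s :: r :: l'); first by rewrite /= sl'.
    rewrite -(opprK e); apply: alternating_prepend => //.
    by rewrite mulNr oppr_lt0.
  + by move: er; rewrite rs ltNge ltW.
apply: (no_sign_pattern e0' (leq_trans sts kdn)) tsP => t /tsI[st [q Iq tq]].
by apply: (itvI Is Iq); rewrite st.
Qed.
End Existence.

(** * Counting components of the zero set *)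

Lemma continuous_within_comp (T U V : topologicalType) (A : set T) (B : set U)
    (g : T -> U) (f : U -> V) :
  {within A, continuous g} -> {within B, continuous f} ->
  (forall s, A s -> B (g s)) -> {within A, continuous (f \o g)}.
Proof.
move=> /subspace_continuousP cg /subspace_continuousP cf AB.
apply/subspace_continuousP => s As P fP.
have := cf _ (AB s As) P fP => fB.
have := cg s As _ fB; apply: filterS2 (withinT _ _) => r Ar.
by apply => //; exact: AB.
Qed.

Lemma connected_closed_cover (T : topologicalType) (C F G : set T) :
  connected C -> closed F -> closed G -> C `<=` F `|` G ->
  C `&` F !=set0 -> C `&` G !=set0 -> C `&` F `&` G !=set0.
Proof.
move=> /connectedP cC cF cG CFG CF CG; apply: contrapT => nCFG.
have disj p : C p -> F p -> G p -> False by move=> ? ? ?; apply: nCFG; exists p.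
apply: (cC (fun b => if b then C `&` G else C `&` F)); split.
- by case.
- apply/seteqP; split=> [p Cp|p [[]|[]]//].
  by have [Fp|Gp] := CFG p Cp; [left|right].
- split; apply/seteqP; split=> // p.
    move=> [clp [Cp Gp]]; apply: (disj p) => //.
    by apply: cF; apply: closureS clp => q [].
  move=> [[Cp Fp] clp]; apply: (disj p) => //.
  by apply: cG; apply: closureS clp => q [].
Qed.

(** * Sign changes between two values of opposite signs *)

Section SignChange.
Variables (R : realType) (d : nat) (K : set 'rV[R]_d).
Implicit Types (f : 'rV[R]_d -> R) (g : R -> 'rV[R]_d) (u v : R).

Lemma within_itv_nbhs (T : topologicalType) u v (g : R -> T) s (P : T -> Prop) :
  {within `[u, v], continuous g} -> u <= s <= v -> (\forall y \near g s, P y) ->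
  exists2 e : R, 0 < e & forall r, u <= r <= v -> s - e < r < s + e -> P (g r).
Proof.
move=> /subspace_continuousP cg us gP.
have : `[u, v]%classic s by rewrite /= in_itv.
move=> /cg/(_ _ gP)/ball_nbhs[e e0 eP]; exists e => // r ur /eP; apply.
by rewrite /= in_itv.
Qed.

(** Let [z] be the supremum of the positive points and [w] the infimum of the negative points after
    [z]. The component containing the image of [[z, w]] has positive values arbitrarily near [g z]
    and negative ones arbitrarily near [g w]. *)
Lemma pos_neg_sign_change f g u v : {within K, continuous f} ->
  {within `[u, v], continuous g} -> (forall s, u <= s <= v -> K (g s)) ->
  u < v -> 0 < f (g u) -> f (g v) < 0 ->
  exists2 z, u < z < v & zero_set K f (g z) /\
    changes_sign_on K f (connected_component (zero_set K f) (g z)).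
Proof.
move=> cf cg gK uv fu fv; pose F := f \o g.
have cF : {within `[u, v], continuous F}.
  by apply: continuous_within_comp cg cf _ => s; rewrite /= in_itv; exact: gK.
have posF s : u <= s <= v -> 0 < F s -> exists2 e : R, 0 < e &
    forall r, u <= r <= v -> s - e < r < s + e -> 0 < F r.
  by move=> us Fs; have [e e0 eP] := within_itv_nbhs cF us (lt_nbhsr Fs);
    exists e.
have negF s : u <= s <= v -> F s < 0 -> exists2 e : R, 0 < e &
    forall r, u <= r <= v -> s - e < r < s + e -> F r < 0.
  by move=> us Fs; have [e e0 eP] := within_itv_nbhs cF us (lt_nbhsl Fs);
    exists e.
pose A := [set s | u <= s <= v /\ 0 < F s].
have Au : A u by split=> //; rewrite lexx ltW.
have hA : has_sup A by split; [exists u|exists v => s [/andP[]]].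
pose z := sup A.
have Az s : A s -> s <= z by apply: ub_le_sup; case: hA.
have uz : u <= z by exact: Az.
have zv : z <= v by apply: ge_sup => //; [exists u|move=> s [/andP[]]].
have Anear e : 0 < e -> exists2 r, A r & z - e < r <= z.
  by move=> e0; have [r Ar zr] := sup_adherent e0 hA; exists r => //;
    rewrite zr Az.
have Fz : F z = 0.
  have uzv : u <= z <= v by rewrite uz.
  case: (ltgtP (F z) 0) => // Fz; exfalso.
    have [e e0 eF] := negF _ uzv Fz;
      have [r [ur Fr] /andP[zr rz]] := Anear e e0.
    have := eF r ur; rewrite zr (le_lt_trans rz) ?ltrDl// => /(_ isT).
    by rewrite ltNge ltW.
  have [e e0 eF] := posF _ uzv Fz.
  have zv' : z < v.
    by rewrite lt_neqAle zv andbT; apply/eqP => zv'; move: Fz;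
      rewrite zv' ltNge ltW.
  pose r := Num.min (z + e / 2) v.
  have zr : z < r by rewrite lt_min ltrDl divr_gt0.
  have ur : u <= r <= v by rewrite (le_trans uz (ltW zr)) ge_min lexx orbT.
  have : A r.
    split=> //; apply: eF => //; rewrite (lt_trans _ zr) ?ltrBlDr ?ltrDl//=.
    by rewrite gt_min ltrD2l ltr_pdivrMr// ltr_pMr// ltr1n.
  by move=> /Az; rewrite leNgt zr.
pose B := [set s | z <= s <= v /\ F s < 0].
have Bv : B v by split; rewrite ?zv ?lexx.
have hB : has_inf B by split; [exists v|exists z => s [/andP[]]].
pose w := inf B.
have Bw s : B s -> w <= s by apply: ge_inf; case: hB.
have wv : w <= v by exact: Bw.
have zw : z <= w by apply: lb_le_inf; [exists v|move=> s [/andP[]]].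
have Bnear e : 0 < e -> exists2 r, B r & w <= r < w + e.
  by move=> e0; have [r Br wr] := inf_adherent e0 hB; exists r => //;
    rewrite wr Bw.
have Fw : F w = 0.
  have uwv : u <= w <= v by rewrite (le_trans uz zw).
  case: (ltgtP (F w) 0) => // Fw; exfalso; last first.
    have [e e0 eF] := posF _ uwv Fw;
      have [r [/andP[zr rv] Fr] /andP[wr rw]] := Bnear e e0.
    have := eF r; rewrite rw (lt_le_trans _ wr) ?ltrBlDr ?ltrDl// (le_trans uz
      zr) rv.
    by move=> /(_ isT isT); rewrite ltNge ltW.
  have [e e0 eF] := negF _ uwv Fw.
  have zw' : z < w.
    by rewrite lt_neqAle zw andbT; apply/eqP => zw'; move: Fw;
      rewrite -zw' Fz ltxx.
  pose r := Num.max (w - e / 2) z.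
  have rw : r < w by rewrite gt_max zw' ltrBlDr ltrDl divr_gt0.
  have zr : z <= r by rewrite le_max lexx orbT.
  have rv : r <= v := le_trans (ltW rw) wv.
  have : B r.
    split; first by rewrite zr.
    apply: eF; first by rewrite (le_trans uz zr).
    rewrite (lt_trans rw) ?ltrDl// andbT lt_max ltrD2l ltrN2.
    by rewrite ltr_pdivrMr// ltr_pMr// ltr1n.
  by move=> /Bw; rewrite leNgt rw.
(* A positive value beyond [z] contradicts the supremum, a negative one before [w] the infimum. *)
have F0 s : z <= s <= w -> F s = 0.
  move=> /andP[zs sw]; apply/eqP; rewrite eq_le; apply/andP; split;
    rewrite leNgt; apply/negP => Fs.
    have : A s by split; rewrite // (le_trans uz zs) (le_trans sw).
    move=> /Az sz; have sE : s = z by apply/eqP; rewrite eq_le sz.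
    by move: Fs; rewrite sE Fz ltxx.
  have : B s by split; rewrite // zs (le_trans sw).
  move=> /Bw ws; have sE : s = w by apply/eqP; rewrite eq_le ws sw.
  by move: Fs; rewrite sE Fw ltxx.
have zz : zero_set K f (g z) by split; [apply: gK; rewrite uz|].
exists z.
  by rewrite !lt_neqAle uz zv !andbT; apply/andP; split; apply/eqP => zE;
    [move: fu; rewrite zE|move: fv; rewrite -zE];
      rewrite (Fz : f (g z) = 0) ltxx.
split=> // U oU CU.
have zwC : g @` `[z, w] `<=` connected_component (zero_set K f) (g z).
  apply: connected_component_max.
  - by exists z => //=; rewrite in_itv /= lexx.
  - move=> _ [s + <-]; rewrite /= in_itv /= => zs; split; last exact: F0.
    by move: zs => /andP[zs sw]; apply: gK;
      rewrite (le_trans uz zs) (le_trans sw).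
  - apply: connected_continuous_connected; first exact: segment_connected.
    apply: continuous_subspaceW cg => s /=; rewrite !in_itv /= => /andP[zs sw].
    by rewrite (le_trans uz zs) (le_trans sw).
have nearU s : z <= s <= w -> exists2 e : R, 0 < e &
    forall r, u <= r <= v -> s - e < r < s + e -> U (g r).
  move=> /andP[zs sw]; apply: (within_itv_nbhs (P := U) cg).
    by rewrite (le_trans uz zs) (le_trans sw).
  apply: open_nbhs_nbhs; split=> //; apply: CU; apply: zwC.
  by exists s => //=; rewrite in_itv /= zs.
have [|e e0 eU] := nearU z; first by rewrite lexx.
have [|e' e'0 e'U] := nearU w; first by rewrite lexx andbT.
have [r [ur Fr] /andP[zr rz]] := Anear e e0.
have [r' [/andP[zr' rv'] Fr'] /andP[wr' rw']] := Bnear e' e'0.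
have ur' : u <= r' <= v by rewrite (le_trans uz zr').
exists (g r), (g r'); split=> //.
- by split; [exact: gK|apply: eU => //; rewrite zr (le_lt_trans rz) ?ltrDl].
- split; first exact: gK.
  by apply: e'U => //; rewrite rw' (lt_le_trans _ wr') ?ltrBlDr ?ltrDl.
Qed.

Lemma sign_change_between f g u v : {within K, continuous f} ->
  {within `[u, v], continuous g} -> (forall s, u <= s <= v -> K (g s)) ->
  u < v -> f (g u) * f (g v) < 0 ->
  exists2 z, u < z < v & zero_set K f (g z) /\
    changes_sign_on K f (connected_component (zero_set K f) (g z)).
Proof.
move=> cf cg gK uv; have [fu|fu|->] := ltgtP (f (g u)) 0;
  last by rewrite mul0r ltxx.
  rewrite nmulr_rlt0// => fv.
  pose f' := \- f.
  have cf' : {within K, continuous f'} by move=> p; apply: continuousN;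
    exact: cf.
  have [||z uz [zz cz]] := @pos_neg_sign_change f' g u v cf' cg gK uv.
  - by rewrite oppr_gt0.
  - by rewrite oppr_lt0.
  have zE : zero_set K f' = zero_set K f.
    apply/seteqP; split=> p [Kp fp]; split=> //.
      by apply/eqP; rewrite -oppr_eq0; apply/eqP.
    by rewrite /f' /= fp oppr0.
  exists z => //; rewrite -zE; split=> // U oU CU.
  have [p [q [Up Uq fp fq]]] := cz U oU CU.
  by exists q, p; split=> //; move: fp fq; rewrite /f' oppr_lt0 oppr_gt0.
by rewrite pmulr_rlt0// => fv; exact: pos_neg_sign_change.
Qed.

(** Each of the [m] gaps of the list yields a component. That different gaps yield different
    components is a hypothesis, because closed and nonclosed curves need different arguments for
    it. *)
Lemma card_sign_changes f g (a b e : R) (l : seq R) m : {within K,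
  continuous f} ->
  {within `[a, b], continuous g} -> (forall s, a <= s <= b -> K (g s)) ->
  size l = m.+1 -> alternating e (f \o g) `[a, b] l ->
  (forall i j z z', (i < j < m)%N ->
     l`_i < z < l`_i.+1 -> l`_j < z' < l`_j.+1 ->
     zero_set K f (g z) -> zero_set K f (g z') ->
     ~ connected_component (zero_set K f) (g z) (g z')) ->
  `I_m #<= sign_changes K f.
Proof.
move=> cf cg gK sl [sol al] sep.
have mem i : (i <= m)%N -> a <= l`_i <= b.
  by move=> im; have [] := al i; rewrite ?sl//= in_itv.
have ltl i : (i < m)%N -> l`_i < l`_i.+1.
  by move=> im; apply: (sorted_ltn_nth lt_trans) => //;
    rewrite inE sl ltnS // ltnW.
have ex i : exists z, (i < m)%N -> l`_i < z < l`_i.+1 /\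
    (zero_set K f (g z) /\
     changes_sign_on K f (connected_component (zero_set K f) (g z))).
  (* The choice function must be total; its value beyond the gaps is arbitrary. *)
  have [im|] := boolP (i < m)%N; last by exists 0.
  have [/andP[ai _] /andP[_ bi]] := (mem i (ltnW im), mem i.+1 im).
  have [||||z lz zP] := @sign_change_between f g l`_i l`_i.+1 cf.
  - apply: continuous_subspaceW cg => s /=; rewrite !in_itv /= => /andP[is_ si].
    by rewrite (le_trans ai) ?(le_trans si).
  - by move=> s /andP[is_ si]; apply: gK; rewrite (le_trans ai) ?(le_trans si).
  - exact: ltl.
  - by apply: (alternating_mul (conj sol al)); rewrite sl.
  by exists z.
have [c cP] := choice ex.
apply: (@card_le_I _ _ _ (fun i =>
  connected_component (zero_set K f) (g (c i)))).
  move=> i im; have [lz [zz cz]] := cP i im; split=> //.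
  by exists (g (c i)).
have inj i j : (i < j < m)%N ->
    connected_component (zero_set K f) (g (c i)) <> connected_component
      (zero_set K f) (g (c j)).
  move=> /[dup] ijm /andP[ij jm] Cij.
  have [lzi [zi _]] := cP i (ltn_trans ij jm); have [lzj [zj _]] := cP j jm.
  apply: (sep i j _ _ ijm lzi lzj zi zj); rewrite Cij.
  exact: connected_component_refl.
move=> i j im jm Cij; have [ij|ji|//] := ltngtP i j.
  by case: (inj i j); rewrite ?ij.
by case: (inj j i); rewrite ?ji.
Qed.

End SignChange.

(** * Distinctness of the components in different gaps *)

Section Separation.
Variables (R : realType) (d : nat) (K : set 'rV[R]_d) (f : 'rV[R]_d -> R).

(** Relative openness of the embedding makes the images of both closed sides of [t] relatively
    closed in [K]. They meet only at [x t], which is not a zero, so no component of the zero set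
    reaches both sides. *)
Lemma embedding_separates (I : set R) (x : R -> 'rV[R]_d) (z t z' : R) :
  embedding_on I x -> x @` I = K -> I z -> I t -> I z' -> z < t < z' ->
  f (x t) != 0 -> zero_set K f (x z) ->
  ~ connected_component (zero_set K f) (x z) (x z').
Proof.
move=> [cx injx openx] xIK Iz It Iz' /andP[zt tz'] ft zz Czz'.
set C := connected_component _ _ in Czz'.
have inj r s : I r -> I s -> x r = x s -> r = s.
  by move=> Ir Is; apply: injx; rewrite inE.
have [V oV VE] := openx [set s | s < t] (@open_lt _ t).
have [V' oV' V'E] := openx [set s | t < s] (@open_gt _ t).
have inV s : I s -> V (x s) <-> s < t.
  move=> Is; split=> [Vs|st].
    have : ((x @` I) `&` V) (x s) by split=> //; exists s.
    by rewrite -VE => -[r [Ir rt] /(inj _ _ Ir Is) <-].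
  by have [] : ((x @` I) `&` V) (x s) by rewrite -VE; exists s.
have inV' s : I s -> V' (x s) <-> t < s.
  move=> Is; split=> [Vs|st].
    have : ((x @` I) `&` V') (x s) by split=> //; exists s.
    by rewrite -V'E => -[r [Ir rt] /(inj _ _ Ir Is) <-].
  by have [] : ((x @` I) `&` V') (x s) by rewrite -V'E; exists s.
have CK p : C p -> exists2 s, I s & x s = p.
  by move=> /(@connected_component_sub _ _ _ _)[]; rewrite -xIK => -[s Is <-];
    exists s.
have [||||||p [[Cp nV'p] nVp]] := @connected_closed_cover _ C (~` V') (~` V).
- exact: component_connected.
- exact: open_closedC.
- exact: open_closedC.
- move=> _ /CK[s Is <-].
  have [st|ts] := ltP s t; first by left => /(inV' s Is); rewrite ltNge ltW.
  by right => /(inV s Is); rewrite ltNge ts.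
- exists (x z); split; first exact: connected_component_refl.
  by move=> /(inV' z Iz); rewrite ltNge ltW.
- by exists (x z'); split=> // /(inV z' Iz'); rewrite ltNge ltW.
have [s Is sp] := CK p Cp; rewrite -{p}sp in Cp nVp nV'p.
have [st|ts|st] := ltgtP s t.
- by apply: nVp; apply/inV.
- by apply: nV'p; apply/inV'.
by have [_ fs] := connected_component_sub Cp; move: ft; rewrite -st fs eqxx.
Qed.

(** One point does not cut a circle, so two are used. The arc over [[p, q]] and its complementary
    arc are compact and can meet only at the images of [p], [q] and the gluing point, where [f] is
    nonzero. *)
Lemma closed_parametrization_separates (a b p q : R) (y : R -> 'rV[R]_d) (z z'
  : R) :
  closed_parametrization K a b y -> a <= p -> q <= b ->
  f (y a) != 0 -> f (y p) != 0 -> f (y q) != 0 ->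
  p < z < q -> q < z' < b -> zero_set K f (y z) ->
  ~ connected_component (zero_set K f) (y z) (y z').
Proof.
move=> [ab cy yab injy yK] ap qb fa fp fq /andP[pz zq] /andP[qz' z'b] zz Czz'.
set C := connected_component _ _ in Czz'.
have closedy u v : a <= u -> v <= b -> closed (y @` `[u, v]).
  move=> au vb; apply: compact_closed; first exact: norm_hausdorff.
  apply: continuous_compact; last exact: segment_compact.
  apply: continuous_subspaceW cy => s /=; rewrite !in_itv /= => /andP[us sv].
  by rewrite (le_trans au) ?(le_trans sv).
have pq : p < q := lt_trans pz zq.
have [||||||c [[Cc [r rpq rc]] Gc]] := @connected_closed_cover _ C
    (y @` `[p, q]) (y @` `[a, p] `|` y @` `[q, b]).
- exact: component_connected.
- by apply: closedy => //; exact: (le_trans ap (ltW _)).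
- by apply: closedU; apply: closedy => //;
  [exact: (le_trans (ltW pq))|exact: (le_trans ap (ltW pq))].
- move=> c /(@connected_component_sub _ _ _ _)[]; rewrite -yK => -[s + <- _].
  rewrite /= in_itv /= => /andP[as_ sb].
  have [sp|ps] := leP s p; first by right; left; exists s;
    rewrite //= in_itv /= as_.
  have [sq|qs] := leP s q; first by left; exists s;
    rewrite //= in_itv /= sq ltW.
  by right; right; exists s; rewrite //= in_itv /= sb ltW.
- exists (y z); split; first exact: connected_component_refl.
  by exists z; rewrite //= in_itv /= !ltW.
- exists (y z'); split=> //; right.
  by exists z'; rewrite //= in_itv /= !ltW.
have [_ fc] := connected_component_sub Cc.
have [r' r'out r'c] : exists2 r', a <= r' <= p \/ q <= r' <= b & y r' = c.
  by case: Gc => -[r' + <-]; rewrite /= in_itv /= => ?; exists r';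
    [left| |right|].
have fb : f (y b) != 0 by rewrite -yab.
have ne s t : f (y t) != 0 -> y s = c -> s != t.
  by move=> ft sc; apply: contraNneq ft => <-; rewrite sc fc.
move: rpq; rewrite /= in_itv /= => /andP[pr rq].
have r'b : a <= r' <= b by case: r'out => /andP[? ?]; apply/andP; split; lra.
have inab s : a <= s <= b -> y s = c -> s \in `[a, b[%classic.
  by move=> /andP[as_ sb] sc;
    rewrite inE /= in_itv /= as_ lt_neqAle sb (ne s b).
have rr' : r = r'.
  apply: injy; [apply: inab => //|exact: inab|by rewrite rc r'c].
  by rewrite (le_trans ap) ?(le_trans rq).
have rp := ne _ _ fp rc; have rq' := ne _ _ fq rc.
case: r'out => /andP[]; rewrite -rr'; last by move=> qr _; case/negP: rq';
  rewrite eq_le rq.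
by move=> _ rp'; case/negP: rp; rewrite eq_le rp'.
Qed.

(** This moves the gluing point to [x s0], so that the first alternating point can become both
    endpoints. *)
Lemma closed_parametrization_rotate (a b s0 : R) (x : R -> 'rV[R]_d) :
  closed_parametrization K a b x -> a < s0 < b ->
  closed_parametrization K s0 (s0 + (b - a))
    (fun s => if s < b then x s else x (s - (b - a))).
Proof.
move=> [ab cx xab injx xK] /andP[as0 s0b]; set T := b - a; set y := fun s => _.
have T0 : 0 < T by rewrite subr_gt0.
have bT : b < s0 + T by rewrite /T; lra.
have yb s : b <= s -> y s = x (s - T) by rewrite /y ltNge => ->.
split.
- by rewrite ltrDl.
(* Continuity is checked on two closed pieces, whose formulas agree at [b] because [x a = x b]. *)
- have -> : `[s0, s0 + T]%classic = `[s0, b] `|` `[b, s0 + T] :> set R.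
    apply/seteqP; split=> s /=; rewrite !in_itv /=.
      by move=> /andP[-> ->]; rewrite andbT /=; case: (leP s b) => [|/ltW];
        [left|right].
    by case=> /andP[s1 s2]; apply/andP; split; lra.
  apply: withinU_continuous; [exact: itv_closed|exact: itv_closed| |].
    have yx : {in `[s0, b]%classic, x =1 y}.
      move=> s; rewrite inE /= in_itv /= => /andP[_];
        rewrite le_eqVlt => /orP[/eqP ->|sb].
        by rewrite yb// /T subKr -xab.
      by rewrite /y sb.
    apply: (subspace_eq_continuous yx).
    apply: continuous_subspaceW cx => s /=; rewrite !in_itv /= => /andP[s1 s2].
    by rewrite s2 (le_trans (ltW as0)).
  have yx : {in `[b, s0 + T]%classic, x \o (fun s => s - T) =1 y}.
    by move=> s; rewrite inE /= in_itv /= => /andP[bs _]; rewrite yb.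
  apply: (subspace_eq_continuous yx).
  apply: (continuous_within_comp (B := `[a, b]%classic)) cx _.
    have cT : continuous (fun s : R => s - T).
      by move=> s; apply: cvgB; [exact: cvg_id|exact: cvg_cst].
    exact: continuous_subspaceT.
  by move=> s /=; rewrite !in_itv /= => /andP[s1 s2]; apply/andP; split;
    rewrite /T in s2 *; lra.
- by rewrite (yb _ (ltW bT)) addrK /y s0b.
- pose r s := if s < b then s else s - T.
  have yr s : y s = x (r s) by rewrite /y /r; case: ifP.
  have rab s : s \in `[s0, s0 + T[%classic -> r s \in `[a, b[%classic.
    rewrite !inE /= !in_itv /= => /andP[s1 s2]; rewrite /r.
    by case: ltP => sb; apply/andP; split; rewrite /T in s2 *; lra.
  move=> s t sI tI; rewrite !yr => /(injx _ _ (rab _ sI) (rab _ tI)).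
  move: sI tI; rewrite !inE /= !in_itv /= /r => /andP[s1 s2] /andP[t1 t2].
  by case: (ltP s b) => sb; case: (ltP t b) => tb; rewrite /T in s2 t2 *; lra.
apply/seteqP; split.
  move=> _ [s + <-]; rewrite /= in_itv /= -xK => /andP[s1 s2].
  rewrite /y; case: ltP => sb.
    by exists s; rewrite //= in_itv /=; apply/andP; split; lra.
  by exists (s - T); rewrite //= in_itv /=; apply/andP; split;
    rewrite /T in s2 *; lra.
rewrite -xK => _ [s + <-]; rewrite /= in_itv /= => /andP[s1 s2].
have [s0s|ss0] := leP s0 s.
  exists s; first by rewrite /= in_itv /= s0s /T; lra.
  have [sb|bs] := ltP s b; first by rewrite /y sb.
  by have -> : s = b; [lra|rewrite yb// /T subKr -xab].
exists (s + T); first by rewrite /= in_itv /= /T; apply/andP; split; lra.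
by rewrite yb ?addrK// /T; lra.
Qed.

End Separation.

(** * The bounds *)

Lemma sorted_nth_le (R : realType) (l : seq R) i j :
  sorted <%R l -> (i <= j < size l)%N -> l`_i <= l`_j.
Proof.
move=> sl /andP[]; rewrite leq_eqVlt => /orP[/eqP -> //|ij] jl.
by apply/ltW/(sorted_ltn_nth lt_trans) => //; rewrite inE (ltn_trans ij).
Qed.

Lemma alternating_hull (R : realType) (e : R) (F : R -> R) (D : set R) l m :
  alternating e F D l -> size l = m.+1 -> alternating e F `[l`_0, l`_m] l.
Proof.
move=> [sol al] sl; split=> // i il; have [_ ?] := al i il; split=> //.
rewrite sl ltnS in il.
rewrite /= in_itv /=; apply/andP.
by split; apply: sorted_nth_le => //; rewrite sl ?ltnS ?il ?leqnn.
Qed.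

Lemma endpoint_ge0 (R : realType) (a b : R) (G : R -> R) : a < b ->
  {within `[a, b], continuous G} -> (forall s, a < s < b -> 0 <= G s) ->
  forall s, a <= s <= b -> 0 <= G s.
Proof.
move=> ab cG G0 s sab; rewrite leNgt; apply/negP => Gs.
have [e e0 eG] := within_itv_nbhs cG sab (lt_nbhsl Gs).
have [r rab rs] : exists2 r, a < r < b & s - e < r < s + e.
  move: sab => /andP[]; rewrite le_eqVlt => /orP[/eqP <- _|as_ sb].
    by exists ((a + Num.min (a + e) b) / 2); case: (leP (a + e) b) => ?; lra.
  by exists ((Num.max (s - e) a + s) / 2); case: (leP (s - e) a) => ?; lra.
have /andP[/ltW ar /ltW rb] := rab.
have := eG r; rewrite ar rb => /(_ isT rs).
by rewrite ltNge G0.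
Qed.

(** The space of dimension 0 has a single point. *)
Lemma curve_dim_gt0 (R : realType) (d : nat) (x : R -> 'rV[R]_d) (D : set R) (s
  t : R) :
  set_inj D x -> D s -> D t -> s != t -> (0 < d)%N.
Proof.
move=> injx Ds Dt st; rewrite lt0n; apply: contra_neqN st => /eqP d0.
apply: injx; rewrite ?inE//; apply/rowP => i; exfalso.
by have := ltn_ord i; rewrite [X in (_ < X)%N]d0.
Qed.

Lemma open_itv_open (R : realType) (a b : \bar R) : open (open_itv a b).
Proof.
have -> : open_itv a b = [set r : R | (a < r%:E)%E] `&` [set r : R | (r%:E <
  b)%E].
  by apply/seteqP; split=> s /andP.
by apply: openI; [exact: open_ereal_gt|exact: open_ereal_lt].
Qed.

Lemma open_itv_interval (R : realType) (a b : \bar R) : is_interval (open_itv a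
  b).
Proof.
move=> s t /andP[as_ _] /andP[_ tb] r /andP[sr rt]; apply/andP; split.
  by apply: lt_le_trans as_ _; rewrite lee_fin.
by apply: le_lt_trans tb; rewrite lee_fin.
Qed.

Lemma open_continuous_within (R : realType) (T : topologicalType) (I : set R)
  (g : R -> T) :
  open I -> {within I, continuous g} -> forall s, I s -> {for s, continuous g}.
Proof. by move=> oI; rewrite continuous_open_subspace// => cg s Is; apply: cg;
  rewrite inE. Qed.

Section SignChangeBound.
Variables (R : realType) (d n : nat) (K : set 'rV[R]_d) (f : 'rV[R]_d -> R).
Hypothesis convK : forall h : 'rV[R]_d * R, h.1 != 0 ->
  (\esum_(p in K `&` hyperplane h) multiplicity K h p <= (d%:R)%:E)%E.
Hypothesis cf : {within K, continuous f}.
Hypothesis f0 : exists2 p, K p & f p != 0.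

Lemma nonclosed_sign_changes (a b : \bar R) (x : R -> 'rV[R]_d) :
  nonclosed_parametrization K a b x ->
  orthogonal_to_polynomials n (open_itv a b) x f ->
  `I_(d * n + 1) #<= sign_changes K f.
Proof.
move=> [ab embx xK] orth; have [cx injx _] := embx.
set I := open_itv a b in embx xK orth cx injx *.
have oI : open I by exact: open_itv_open.
have itvI : is_interval I by exact: open_itv_interval.
have xIK s : I s -> K (x s) by move=> Is; rewrite -xK; exists s.
have cF : {within I, continuous (f \o x)} by exact: continuous_within_comp cx
  cf xIK.
have [s Is fs] : exists2 s, I s & f (x s) != 0.
  by have [p + fp] := f0; rewrite -xK => -[s Is sp]; exists s; rewrite ?sp.
have d0 : (0 < d)%N.
  have /filter_ex[r [sr Ir]] : \forall r \near s^'+, s < r /\ I r.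
    apply: filterI; first exact: nbhs_right_gt.
    exact: near_right_nbhs (open_nbhs_nbhs (conj oI Is)).
  by apply: (curve_dim_gt0 injx Is Ir); rewrite lt_eqF.
have [e [l sl al]] := exists_alternating convK oI itvI
  (open_continuous_within oI cx) injx xIK d0 (open_continuous_within oI cF)
  (ex_intro2 _ _ s Is fs) orth.
have Il i : (i < (d * n).+2)%N -> I l`_i /\ f (x l`_i) != 0.
  move=> il; have [Ii Fi] : I l`_i /\ 0 < e * (-1) ^+ i * (f \o x) l`_i by
    apply: al.2; rewrite sl.
  by split=> //; apply: contraTneq Fi => /= ->; rewrite mulr0 ltxx.
have hull r : l`_0 <= r <= l`_(d * n).+1 -> I r.
  by apply: itvI; [exact: (Il 0%N isT).1|exact: (Il _ (ltnSn _)).1].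
rewrite addn1; apply: (card_sign_changes (g :=
  x) cf _ _ sl (alternating_hull al sl)).
- by apply: continuous_subspaceW cx => r /=; rewrite in_itv; exact: hull.
- by move=> r /hull/xIK.
move=> i j z z' /andP[ij jm] /andP[iz zi] /andP[jz zj] zz _.
have Ii k : (k <= (d * n).+1)%N -> I l`_k by move=> kd; exact: (Il k kd).1.
have lij : l`_i.+1 <= l`_j.
  by apply: (sorted_nth_le al.1); rewrite sl ij ltnS ltnW.
have im : (i < (d * n).+1)%N by exact: ltn_trans ij jm.
(* The right end of gap [i] precedes gap [j], and [f] is nonzero there. *)
apply: (@embedding_separates _ _ _ _ _ _ _ l`_i.+1 _ embx xK) => //.
- by apply: (itvI _ _ (Ii i (ltnW im)) (Ii i.+1 im)); rewrite !ltW.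
- exact: Ii.
- by apply: (itvI _ _ (Ii j (ltnW jm)) (Ii j.+1 jm)); rewrite !ltW.
- by rewrite zi (le_lt_trans lij).
- exact: (Il i.+1 im).2.
Qed.

(** An affine function with [d] zeros inside the interval has the same nonzero value at both ends,
    whereas its sign pattern changes by the factor [(-1) ^+ d]. *)
Lemma closed_convex_curve_even (a b : R) (x : R -> 'rV[R]_d) :
  closed_parametrization K a b x -> ~~ odd d.
Proof.
move=> [ab cx xab injx xK].
pose I := `]a, b[%classic : set R.
have oI : open I by exact: interval_open.
have itvI : is_interval I by exact: interval_is_interval.
have Iab s : I s -> s \in `[a, b[%classic.
  by rewrite inE /I /= !in_itv /= => /andP[/ltW -> ->].
have injI : set_inj I x by move=> s t; rewrite !inE => /Iab ? /Iab ?;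
  exact: injx.
have xIK s : I s -> K (x s).
  by rewrite /I /= in_itv /= => /andP[as_ sb]; rewrite -xK; exists s;
    rewrite //= in_itv /= !ltW.
have cxI : {within I, continuous x}.
  by apply: continuous_subspaceW cx => s;
    rewrite /I /= !in_itv /= => /andP[/ltW -> /ltW].
have I0 : I !=set0 by exists ((a + b) / 2); rewrite /I /= in_itv /=;
  apply/andP; split; lra.
have [//|d0] := posnP d; first by move=> ->.
(* With both lists empty, this just provides [d] distinct points of [I]. *)
have [|||ts [uts sts tsI _]] := @sgn_prod_perturb R I [::] [::] d oI I0 => //.
have [h [h0 hz ht hP]] := interpolating_affine convK oI itvI
  (open_continuous_within oI cxI) injI xIK d0 uts sts tsI.
have h10 : h.1 != 0.
  have [_ nz] := affine_curve_zeros convK injI xIK d0 h0 uts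
    (fun t tts => conj (tsI t tts) (ht t tts)).
  by case: ts sts nz {uts tsI hz ht hP} =>
    [dd|t ts _ /(_ t (mem_head _ _)) //]; rewrite -dd in d0.
have Ka : K (x a) by rewrite -xK; exists a; rewrite //= in_itv /= lexx ltW.
(* The point [x a] is not in the image of [I], so a zero there would be number [d + 1]. *)
have ha : affine h (x a) != 0.
  apply/eqP => ha.
  have : (\sum_(p <- x a :: map x ts) 1 <= d)%N.
    apply: (@sum_perturbs _ _ K h (fun=> 1)); first exact: convK.
      rewrite /= map_inj_in_uniq// => [|s t /tsI Is /tsI It];
        last by apply: injI; rewrite inE.
      rewrite uts andbT; apply/mapP => -[t /tsI It xat].
      have : a = t by apply: injx => //;
        [rewrite inE /= in_itv /= lexx|exact: Iab].
      by move: It; rewrite /I /= in_itv /= => /andP[+ _] => /[swap] <-;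
        rewrite ltxx.
    move=> p; rewrite inE => /orP[/eqP ->|/mapP[t tts ->]].
      by have ? := (hyperplaneE _ _).2 ha; split=> //; exact: perturbs_one.
    have ? := (hyperplaneE _ _).2 (ht t tts); have ? := xIK _ (tsI t tts).
    by split=> //; exact: perturbs_one.
  by rewrite sum1_size /= size_map sts ltnn.
have cG : {within `[a, b], continuous (fun s =>
  affine h (x s) * sgn_prod ts s)}.
  have c1 : {within `[a, b], continuous (affine h \o x)}.
    apply: (continuous_within_comp (B := setT)) cx _ _ => //.
    by apply: continuous_subspaceT; exact: affine_continuous.
  have c2 : {within `[a, b], continuous (sgn_prod ts)}.
    by apply: continuous_subspaceT; exact: sgn_prod_continuous.
  by move=> s; exact: (continuousM (c1 s) (c2 s)).
have G0 := endpoint_ge0 ab cG.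
have {}G0 s : a <= s <= b -> 0 <= affine h (x s) * sgn_prod ts s.
  by apply: G0 => r rab; apply: hP; rewrite /I /= in_itv.
have Pa : 0 < sgn_prod ts a.
  rewrite /sgn_prod big_seq; apply: prodr_gt0 => t /tsI.
  by rewrite /I /= in_itv /= subr_gt0 => /andP[].
have Pb : 0 < (-1) ^+ d * sgn_prod ts b.
  rewrite -sts; elim: (ts) tsI => [_|t us IH usI].
    by rewrite /sgn_prod big_nil mulr1.
  rewrite sgn_prod_cons exprS mulrACA mulr_gt0 ?IH//.
    have := usI t (mem_head _ _).
    by rewrite /I /= in_itv /= mulN1r opprB subr_gt0 => /andP[].
  by move=> r rus; apply: usI; rewrite inE rus orbT.
have ha0 : 0 < affine h (x a).
  by rewrite lt0r ha -(pmulr_lge0 _ Pa) G0// lexx ltW.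
have := G0 b; rewrite lexx ltW// => /(_ isT).
rewrite -xab pmulr_rge0// => Pb0.
move: Pb; rewrite -signr_odd; case: (odd d) => //.
by rewrite expr1 mulN1r oppr_gt0 ltNge Pb0.
Qed.

(** Alternation is obtained on the open interval; rotating to its first point and repeating that
    point at the end gives [d * n + 3] parameters, hence [d * n + 2] gaps. *)
Lemma closed_sign_changes (a b : R) (x : R -> 'rV[R]_d) :
  closed_parametrization K a b x ->
  orthogonal_to_polynomials n `[a, b] x f ->
  `I_(d * n + 2) #<= sign_changes K f.
Proof.
move=> parx orth; have [ab cx xab injx xK] := parx.
have even_d := closed_convex_curve_even parx.
pose I := `]a, b[%classic : set R.
have oI : open I by exact: interval_open.
have itvI : is_interval I by exact: interval_is_interval.
have Iab s : I s -> s \in `[a, b[%classic.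
  by rewrite inE /I /= !in_itv /= => /andP[/ltW -> ->].
have injI : set_inj I x by move=> s t; rewrite !inE => /Iab ? /Iab ?;
  exact: injx.
have Isub : I `<=` `[a, b].
  by move=> s; rewrite /I /= !in_itv /= => /andP[/ltW -> /ltW].
have xK' s : a <= s <= b -> K (x s).
  by move=> sab; rewrite -xK; exists s; rewrite //= in_itv.
have xIK s : I s -> K (x s) by move=> Is; rewrite -xK; exists s => //;
  exact: Isub.
have cF : {within `[a, b], continuous (f \o x)}.
  by apply: continuous_within_comp cx cf _ => s; rewrite /= in_itv; exact: xK'.
have cxI := continuous_subspaceW Isub cx.
have cFI := continuous_subspaceW Isub cF.
have F0 : exists2 s, I s & (f \o x) s != 0.
  apply: contrapT => nF; have [p + fp] := f0; rewrite -xK => -[s sab sp].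
  have FI r : a < r < b -> f (x r) = 0.
    by move=> rab; apply/eqP; apply: contrapT => /negP ?; apply: nF; exists r;
      rewrite // /I /= in_itv.
  rewrite /= in_itv /= in sab.
  case/negP: fp; rewrite -sp eq_le; apply/andP; split; last first.
    by apply: (endpoint_ge0 ab cF) sab => r /FI /= ->.
  rewrite -oppr_ge0.
  apply: (@endpoint_ge0 _ _ _ (fun s => - f (x s)) ab _ _ s sab) =>
    [r|r /FI ->]; last by rewrite oppr0.
  by apply: continuousN; exact: cF.
have d0 : (0 < d)%N.
  apply: (@curve_dim_gt0 _ _ _ _ a ((a + b) / 2) injx); rewrite /= ?in_itv /=.
  - by rewrite lexx.
  - by apply/andP; split; lra.
  - by rewrite lt_eqF//; lra.
(* The two endpoints removed from the domain form a null set. *)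
have orthI : orthogonal_to_polynomials n I x f.
  move=> P dP; have [iG intG] := orth P dP.
  have iGI : lebesgue_measure.-integrable I
      (EFin \o (fun s => MPolynomial.eval P (x s) * f (x s))).
    by apply: integrableS iG => //; exact: measurable_itv.
  split=> //; rewrite -[RHS]intG /I -(@integral_itv_bndoo _ _ _ _ true false)//.
  exact: measurable_int iGI.
have [e [l sl al]] := exists_alternating convK oI itvI
  (open_continuous_within oI cxI) injI xIK d0 (open_continuous_within oI cFI)
    F0 orthI.
have Il i : (i < (d * n).+2)%N -> I l`_i /\ 0 < e * (-1) ^+ i * (f \o x) l`_i.
  by move=> il; apply: al.2; rewrite sl.
set s0 := l`_0.
have [Is0 Fs0] := Il 0%N isT.
have s0ab : a < s0 < b by move: Is0; rewrite /I /= in_itv.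
have pary := closed_parametrization_rotate parx s0ab.
set y := (fun s => _) in pary; set b' := s0 + _ in pary.
have [ab' cy yab injy yK] := pary.
have yx s : s < b -> y s = x s by rewrite /y => ->.
have ltb i : (i < (d * n).+2)%N -> l`_i < b.
  by move=> /Il[]; rewrite /I /= in_itv /= => /andP[].
have bb' : b < b' by rewrite /b'; lra.
pose l' := rcons l b'.
have sl' : size l' = (d * n + 2).+1 by rewrite size_rcons sl addn2.
have l'E i : (i < (d * n).+2)%N -> l'`_i = l`_i by rewrite nth_rcons sl => ->.
have l'last : l'`_(d * n).+2 = b' by rewrite nth_rcons sl ltnn eqxx.
have al' : alternating e (f \o y) setT l'.
  split.
    have ltb' r : r \in l -> r < b'.
      move=> /(alternating_mem al); rewrite /I /= in_itv /= => /andP[_ rb].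
      exact: lt_trans bb'.
    rewrite /l'; case: (l) al.1 ltb' => //= t us sus ltb'.
    by rewrite rcons_path sus ltb'// mem_last.
  move=> i; rewrite sl' addn2 ltnS leq_eqVlt => /orP[/eqP ->|il]; split=> //;
    last first.
    by rewrite l'E// /= yx ?ltb//; exact: (Il i il).2.
  rewrite l'last /= -yab yx; last by case/andP: s0ab.
  (* The last index [d * n + 2] is even, so the sign required there is that of the first value,
     which it repeats. *)
  rewrite -signr_odd /= oddM (negbTE even_d) /=.
  exact: Fs0.
have fy i : (i <= (d * n).+2)%N -> f (y l'`_i) != 0.
  move=> il; have [|_ Fi] := al'.2 i; first by rewrite sl' addn2.
  by apply: contraTneq Fi => /= ->; rewrite mulr0 ltxx.
have l'_le i j : (i <= j <= (d * n).+2)%N -> l'`_i <= l'`_j.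
  by move=> ijd; apply: (sorted_nth_le al'.1); rewrite sl' addn2 ltnS.
have hl' : alternating e (f \o y) `[s0, b'] l'.
  by have := alternating_hull al' sl'; rewrite addn2 l'last l'E.
apply: (card_sign_changes (g := y) cf cy _ sl' hl').
- by move=> s sab; rewrite -yK; exists s; rewrite //= in_itv.
rewrite addn2 => i j z z' /andP[ij jm] iz /andP[jz zj] zz _.
(* The ends of gap [i] are the two cut points; gap [j] lies between the second one and [b']. *)
apply: (@closed_parametrization_separates _ _ _ f _ _ l'`_i l'`_i.+1 _ _ _
  pary) => //.
- have <- : l'`_0 = s0 by rewrite l'E.
  by apply: l'_le; rewrite /= ltnW// (ltn_trans ij).
- by rewrite -l'last l'_le// leqnn andbT (ltn_trans ij).
- by have := fy 0%N isT; rewrite l'E.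
- by apply: fy; rewrite ltnW// (ltn_trans ij).
- by apply: fy; rewrite (ltn_trans ij).
- apply/andP; split; first by apply: le_lt_trans jz; rewrite l'_le// ij ltnW.
  by apply: lt_le_trans zj _; rewrite -l'last l'_le// jm /=.
Qed.

End SignChangeBound.

Theorem theorem5 (R : realType) (d n : nat) (K : set 'rV[R]_d)
    (f : 'rV[R]_d -> R)
    (hK : convex_curve K)
    (hf : {within K, continuous f})
    (hf0 : exists2 p, K p & f p != 0) :
  (closed_curve K ->
     (exists (alpha beta : R) (x : R -> 'rV[R]_d),
        closed_parametrization K alpha beta x /\
        orthogonal_to_polynomials n `[alpha, beta] x f) ->
     `I_(d * n + 2) #<= sign_changes K f) /\
  (nonclosed_curve K ->
     (exists (a b : \bar R) (x : R -> 'rV[R]_d),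
        nonclosed_parametrization K a b x /\
        orthogonal_to_polynomials n (open_itv a b) x f) ->
     `I_(d * n + 1) #<= sign_changes K f).
Proof.
have [_ convK] := hK; split=> _.
  by move=> [a [b [x [parx orth]]]]; exact: closed_sign_changes parx orth.
by move=> [a [b [x [parx orth]]]]; exact: nonclosed_sign_changes parx orth.
Qed.
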